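(* Let the data set $(B_1,B_2,C_1,C_2,K)$ satisfy $$K(B_2h,B_1g)-K(B_1h,B_2g)=(C_1h,C_2g)_{\mathcal L}-(C_2h,C_1g)_{\mathcal L}\qquad(h,g\in\mathcal X).$$ Then Problem $AIP(B_1,B_2,C_1,C_2,K)$ is solvable, and the set of its normalized solutions $\{\varphi,\psi\}$ is parametrized by the formula $$\begin{bmatrix}\psi(\lambda)\\ \varphi(\lambda)\end{bmatrix}=\begin{bmatrix}I_{\mathcal L}&0\\ \lambda I_{\mathcal L}&I_{\mathcal L}\end{bmatrix}\begin{bmatrix}P_{\mathcal L}(\widetilde A-\lambda)^{-1}|_{\mathcal L}\\ I_{\mathcal L}\end{bmatrix}\qquad(\lambda\in\mathbb C\setminus\mathbb R),$$ where $\widetilde A$ ranges over the set of all selfadjoint extensions of $\widehat A$ with exit into a Hilbert space $\widetilde{\mathcal H}\oplus\mathcal L\supset\mathcal H\oplus\mathcal L$. The corresponding linear mapping $F:\mathcal X\to\mathcal H(\varphi,\psi)$ is given by $$(Fh)(\lambda)=P_{\mathcal L}(\widetilde A-\lambda)^{-1}\widehat h,\qquad h\in\mathcal X.$$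
   Context: Data set: $\mathcal X$ is a complex linear space, $\mathcal L$ a Hilbert space, $B_1,B_2$ linear operators in $\mathcal X$, $C_1,C_2$ linear operators from $\mathcal X$ to $\mathcal L$, $K$ a nonnegative sesquilinear form on $\mathcal X$ (linear in the first argument). A Nevanlinna pair $\{\Phi,\Psi\}$ in $\mathcal L$ is a pair of functions holomorphic on $\mathbb C\setminus\mathbb R$ with values in the bounded operators on $\mathcal L$ such that (i) the kernel $\mathsf N^{\Phi\Psi}_\omega(\lambda)=\frac{\Psi(\bar\lambda)^*\Phi(\bar\omega)-\Phi(\bar\lambda)^*\Psi(\bar\omega)}{\lambda-\bar\omega}$ is nonnegative on $\mathbb C_+$; (ii) $\Psi(\bar\lambda)^*\Phi(\lambda)-\Phi(\bar\lambda)^*\Psi(\lambda)=0$ for $\lambda\in\mathbb C\setminus\mathbb R$; (iii) $\Phi(\lambda)-\lambda\Psi(\lambda)$ is boundedly invertible for $\lambda\in\mathbb C\setminus\mathbb R$. It is normalized if $\Phi(\lambda)-\lambda\Psi(\lambda)=I_{\mathcal L}$. $\mathcal H(\Phi,\Psi)$ is the reproducing kernel Hilbert space of $\mathcal L$-valued functions on $\mathbb C\setminus\mathbb R$ with kernel $\mathsf N^{\Phi\Psi}_\omega(\lambda)$ (extended by continuity to $\lambda=\bar\omega$): $\langle f,\mathsf N^{\Phi\Psi}_\omega(\cdot)u\rangle=(f(\omega),u)_{\mathcal L}$. Problem $AIP(B_1,B_2,C_1,C_2,K)$: find a normalized Nevanlinna pair $\{\varphi,\psi\}$ in $\mathcal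 L$ such that for some linear mapping $F:\mathcal X\to\mathcal H(\varphi,\psi)$ and all $h\in\mathcal X$: (C1) $(FB_2h)(\lambda)-\lambda(FB_1h)(\lambda)=\varphi(\lambda)C_1h-\psi(\lambda)C_2h$; (C2) $\|Fh\|^2_{\mathcal H(\varphi,\psi)}\le K(h,h)$. $\mathcal H$ is the completion of $\mathcal X/\ker K$, $\ker K=\{h:K(h,h)=0\}$, with inner product $(\widehat h,\widehat g)_{\mathcal H}=K(h,g)$, $\widehat h=h+\ker K$. $\widehat A$ is the (symmetric) linear relation in $\mathcal H\oplus\mathcal L$ $$\widehat A=\left\{\left\{\begin{bmatrix}\widehat{B_1h}\\ C_1h\end{bmatrix},\begin{bmatrix}\widehat{B_2h}\\ C_2h\end{bmatrix}\right\}:h\in\mathcal X\right\}.$$ A selfadjoint extension of $\widehat A$ with exit is a selfadjoint linear relation $\widetilde A\supset\widehat A$ in $\widetilde{\mathcal H}\oplus\mathcal L$, with $\widetilde{\mathcal H}$ a Hilbert space containing $\mathcal H$ as a closed subspace. $P_{\mathcal L}$ is the orthogonal projection onto $\mathcal L$; $\widehat h\in\mathcal H$ is identified with $\begin{bmatrix}\widehat h\\0\end{bmatrix}$. The corresponding mapping $F$ is the one satisfying (C1), (C2). *)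

(* Defs.v *)
From HB Require Import structures.
From mathcomp Require Import all_boot all_order all_algebra.
From mathcomp Require Import sesquilinear complex.
From mathcomp Require Import all_classical all_reals.
From mathcomp Require Import topology normedtype.

Set Implicit Arguments.
Unset Strict Implicit.
Unset Printing Implicit Defensive.

Import Order.TTheory GRing.Theory Num.Theory.
Import numFieldNormedType.Exports.

Local Open Scope classical_set_scope.
Local Open Scope ring_scope.

(* Inner products and sesquilinear forms are linear in the first argument and
   conjugate-linear in the second one. *)

HB.mixin Record NormedModule_isHilbert (R : realType) T
    of CompleteNormedModule R[i] T := {
  hdot : {dot T for (Num.conj : R[i] -> R[i])} ;
  sqr_norm_hdot : forall x : T, `|x| ^+ 2 = hdot x x
}.

#[short(type="hilbertType")]
HB.structure Definition Hilbert (R : realType) :=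
  {T of CompleteNormedModule R[i] T & NormedModule_isHilbert R T}.

Notation "'[< x , y >]" := (hdot x y)
  (at level 0, x at level 99, y at level 99) : ring_scope.

Definition nonreal (R : realType) (z : R[i]) : Prop := 'Im z != 0.
Definition upper_half (R : realType) (z : R[i]) : Prop := 0 < 'Im z.

Section Operators.
Variables (R : realType) (L : hilbertType R).

Definition bounded_op (T : {linear L -> L}) : Prop :=
  exists M : R[i], forall u, `|T u| <= M * `|u|.

Definition boundedly_invertible (T : L -> L) : Prop :=
  exists S : {linear L -> L}, [/\ bounded_op S, cancel T S & cancel S T].

(* For bounded T, adjoint T v is the Riesz representative of u |-> (T u, v). *)
Definition adjoint (T : L -> L) (v : L) : L :=
  xget 0 [set w | forall u, '[< T u, v >] = '[< u, w >]].

(* Functions on C \ R are represented by total functions on C, and every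
   condition below only concerns the values at nonreal points. *)
Definition opfun : Type := R[i] -> {linear L -> L}.

(* Complex differentiability with respect to the operator norm. *)
Definition holomorphic (Phi : opfun) : Prop :=
  (forall z, nonreal z -> bounded_op (Phi z)) /\
  (forall z, nonreal z -> exists2 D : {linear L -> L}, bounded_op D &
    forall eps : R[i], 0 < eps -> \forall h \near (0 : R[i]^o)^', forall u : L,
      `|h^-1 *: (Phi (z + h) u - Phi z u) - D u| <= eps * `|u|).

Definition nkernel0 (Phi Psi : opfun) (omega lambda : R[i]) (u : L) : L :=
  (lambda - omega^*)^-1 *:
    (adjoint (Psi lambda^*) (Phi omega^* u)
     - adjoint (Phi lambda^*) (Psi omega^* u)).

(* nkernel Phi Psi omega lambda is N_omega(lambda), with its extension by
   continuity in lambda to the point omega^*. *)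
Definition nkernel (Phi Psi : opfun) (omega lambda : R[i]) (u : L) : L :=
  if lambda == omega^* then
    lim (nkernel0 Phi Psi omega l u @[l --> (omega^* : R[i]^o)^'])
  else nkernel0 Phi Psi omega lambda u.

Definition nonneg_kernel_on (D : R[i] -> Prop)
    (N : R[i] -> R[i] -> L -> L) : Prop :=
  forall (n : nat) (w : 'I_n -> R[i]) (u : 'I_n -> L), (forall i, D (w i)) ->
    0 <= \sum_i \sum_j '[< N (w i) (w j) (u i), u j >].

Definition nevanlinna_pair (Phi Psi : opfun) : Prop :=
  [/\ holomorphic Phi /\ holomorphic Psi,
      nonneg_kernel_on (@upper_half R) (nkernel Phi Psi),
      forall z, nonreal z -> forall u,
        adjoint (Psi z^*) (Phi z u) - adjoint (Phi z^*) (Psi z u) = 0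
    & forall z, nonreal z ->
        boundedly_invertible (fun u => Phi z u - z *: Psi z u)].

Definition normalized_nevanlinna_pair (Phi Psi : opfun) : Prop :=
  nevanlinna_pair Phi Psi /\
  (forall z, nonreal z -> forall u, Phi z u - z *: Psi z u = u).

(* The reproducing kernel Hilbert space of L-valued functions on C \ R with
   kernel N (unique up to a unitary map compatible with ev): the value at z of
   the function f is ev z f, and f is determined by its values. *)
Record rkhs (N : R[i] -> R[i] -> L -> L) := Rkhs {
  rkhs_space :> hilbertType R ;
  ev : R[i] -> {linear rkhs_space -> L} ;
  ev_inj : forall f g : rkhs_space,
    (forall z, nonreal z -> ev z f = ev z g) -> f = g ;
  ev_kernel : forall (omega : R[i]) (u : L), nonreal omega ->
    exists k : rkhs_space,
      (forall z, nonreal z -> ev z k = N omega z u) /\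
      (forall f : rkhs_space, '[< f, k >] = '[< ev omega f, u >])
}.

End Operators.

Section Problem.
Variables (R : realType) (X : lmodType R[i]) (L : hilbertType R).
Variables (B1 B2 : {linear X -> X}) (C1 C2 : {linear X -> L}).
Variable K : {bilinear X -> X -> R[i] | *%R & (Num.conj : R[i] -> R[i]) \; *%R}.

Definition aip_mapping (phi psi : opfun L) (S : rkhs (nkernel phi psi))
    (F : {linear X -> S}) : Prop :=
  (forall h z, nonreal z ->
     ev S z (F (B2 h)) - z *: ev S z (F (B1 h))
     = phi z (C1 h) - psi z (C2 h)) /\
  (forall h, `|F h| ^+ 2 <= K h h).

Definition aip_solution (phi psi : opfun L) : Prop :=
  normalized_nevanlinna_pair phi psi /\
  exists (S : rkhs (nkernel phi psi)) (F : {linear X -> S}), aip_mapping F.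

(* (H, hat) is the completion of the quotient of X by the kernel of K: the
   identity for inner products makes ker hat equal to ker K. *)
Definition is_completion (H : hilbertType R) (hat : {linear X -> H}) : Prop :=
  (forall h g, '[< hat h, hat g >] = K h g) /\ dense (range hat).

End Problem.

Section Relations.
Variables (R : realType) (H L : hilbertType R).

(* The inner product of the orthogonal sum of H and L.  The norm of H * L in
   the library is the (equivalent) maximum norm; the notions below only use
   the linear structure and this inner product. *)
Definition sdot (x y : H * L) : R[i] := '[< x.1, y.1 >] + '[< x.2, y.2 >].

Definition relation_adjoint (A : set ((H * L) * (H * L))) :
    set ((H * L) * (H * L)) :=
  [set p | forall q, A q -> sdot q.2 p.1 = sdot q.1 p.2].

(* Adjoints are linear subspaces, hence so are selfadjoint relations. *)
Definition selfadjoint_relation (A : set ((H * L) * (H * L))) : Prop :=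
  A = relation_adjoint A.

Definition resolvent (A : set ((H * L) * (H * L))) (z : R[i]) :
    set ((H * L) * (H * L)) :=
  [set (q.2 - z *: q.1, q.1) | q in A].

(* P_L (A - z)^-1, as a linear relation from H * L to L. *)
Definition compressed_resolvent (A : set ((H * L) * (H * L))) (z : R[i]) :
    set ((H * L) * L) :=
  [set (q.1, q.2.2) | q in resolvent A z].

End Relations.

Section Extensions.
Variables (R : realType) (X : lmodType R[i]) (L : hilbertType R).
Variables (B1 B2 : {linear X -> X}) (C1 C2 : {linear X -> L}).
Variables (H : hilbertType R) (hat : {linear X -> H}).

Definition Ahat : set ((H * L) * (H * L)) :=
  [set ((hat (B1 h), C1 h), (hat (B2 h), C2 h)) | h in setT].

(* The inclusion of H in the larger space is an isometry exit_incl; its range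
   is closed because H is complete. *)
Record sa_extension_with_exit := SaExtension {
  exit_space : hilbertType R ;
  exit_incl : {linear H -> exit_space} ;
  exit_incl_isometry : forall x y,
    '[< exit_incl x, exit_incl y >] = '[< x, y >] ;
  exit_rel : set ((exit_space * L) * (exit_space * L)) ;
  exit_rel_selfadjoint : selfadjoint_relation exit_rel ;
  exit_rel_extends : forall x u y v,
    Ahat ((x, u), (y, v)) -> exit_rel ((exit_incl x, u), (exit_incl y, v))
}.
Arguments exit_rel : clear implicits.

(* psi(z) = P_L (A~ - z)^-1 |_L  (as an identity between the graph of psi(z)
   and a linear relation), and phi(z) = z P_L (A~ - z)^-1 |_L + I. *)
Definition param_formula (E : sa_extension_with_exit) (phi psi : opfun L) :
    Prop :=
  forall z, nonreal z ->
    (forall u v, psi z u = v <->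
       compressed_resolvent (exit_rel E) z ((0, u), v)) /\
    (forall u, phi z u = z *: psi z u + u).

(* (F h)(z) = P_L (A~ - z)^-1 hat(h). *)
Definition mapping_formula (E : sa_extension_with_exit) (phi psi : opfun L)
    (S : rkhs (nkernel phi psi)) (F : {linear X -> S}) : Prop :=
  forall h z, nonreal z -> forall v, ev S z (F h) = v <->
    compressed_resolvent (exit_rel E) z ((exit_incl E (hat h), 0), v).

End Extensions.

Arguments exit_rel {R X L B1 B2 C1 C2 H hat} s _.

(* Main.v *)
Require Import Defs.
From HB Require Import structures.
From mathcomp Require Import all_boot all_order all_algebra.
From mathcomp Require Import sesquilinear complex.
From mathcomp Require Import all_classical all_reals.
From mathcomp Require Import topology normedtype.
From mathcomp Require Import ring lra.

Set Implicit Arguments.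
Unset Strict Implicit.
Unset Printing Implicit Defensive.

Import Order.TTheory GRing.Theory Num.Theory.
Import numFieldNormedType.Exports.

Local Open Scope classical_set_scope.
Local Open Scope ring_scope.

(** A normalized pair is determined by psi, since phi(z) = z psi(z) + 1, and
    the theorem says that the psi solving the problem are the compressed
    resolvents of the selfadjoint extensions of the data relation.

    From an extension to a solution.  Let A be selfadjoint in E + L and let
    R(z) be its resolvent.  The resolvent identity turns the kernel of the pair
    into N_w(z) u = P_L R(z) P_E R(w^* ) u, and R(w^* ) is the adjoint of R(w),
    so N is the reproducing kernel of the functions z |-> P_L R(z) f, f in E.
    It is therefore nonnegative, and its reproducing kernel space is the
    orthogonal complement of the vectors f whose function vanishes.  The
    function F h is the image of the vector of h; R(z) applied to an element of
    the data relation gives the interpolation equation, and projecting cannot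
    increase norms.  See [resolvent_pair_nevanlinna], [resolvent_rkhs_ex] and
    [extension_gives_solution].

    From a solution to an extension.  In S + L, where S is the space of the
    pair, consider the relation of all ((f, u), (f', u')) such that
    f'(z) - z f(z) = phi(z) u - psi(z) u'.  It is the adjoint of the symmetric
    relation formed by the kernel functions, whose deficiency spaces vanish, so
    it is selfadjoint ([model_selfadjoint]); its compressed resolvent is psi,
    and the interpolation equation says that it contains the image of the data
    under F.  Since F need not be isometric, the defect form
    K(h, g) - (F h, F g) remains.  It is nonnegative, and the data induce a
    symmetric relation in its completion, which has a selfadjoint extension.
    The orthogonal sum of both selfadjoint relations is the required extension:
    h |-> (F h, class of h) preserves K, hence extends to an isometry of H
    because the classes of X are dense ([solution_gives_extension]).

    Every symmetric relation A in a space V has a selfadjoint extension in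
    V + V given by an explicit formula in terms of the adjoint and the second
    adjoint of A ([radj_dilation]).  This gives the extension needed for the
    defect form and, with the completion of X, the existence of a solution.

    The Hilbert space theory is developed for an inner product given as a
    function on a module, so that it applies to the sum of two Hilbert spaces
    with its Euclidean inner product as well as to Hilbert spaces themselves;
    an inner product that is complete is turned into a Hilbert space by
    [form_space]. *)

(** * Complex moduli as real numbers *)

Notation cmod := ComplexField.Normc.normc.

Section ComplexModulus.
Variable R : realType.
Implicit Types (z w : R[i]) (r : R).

Lemma cmodE z : `|z| = (cmod z)%:C%C. Proof. by []. Qed.

Lemma cmod_ge0 z : 0 <= cmod z.
Proof. by case: z => a b; exact: sqrtr_ge0. Qed.

Lemma cmodJ z : cmod z^* = cmod z.
Proof. by case: z => a b; rewrite /= sqrrN. Qed.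

Lemma cmodN z : cmod (- z) = cmod z. Proof. exact: normcN. Qed.

Lemma cmodB z w : cmod (z - w) = cmod (w - z).
Proof. by rewrite -cmodN opprB. Qed.

Lemma cmod_real r : cmod r%:C%C = `|r|.
Proof. by rewrite /= expr0n /= addr0 sqrtr_sqr. Qed.

Lemma cmodD z w : cmod (z + w) <= cmod z + cmod w. Proof. exact: le_normcD. Qed.

Lemma cmod_sqr z : cmod z ^+ 2 = complex.Re z ^+ 2 + complex.Im z ^+ 2.
Proof. by case: z => a b; rewrite /= sqr_sqrtr // addr_ge0 // sqr_ge0. Qed.

Lemma Re_le_cmod z : complex.Re z <= cmod z.
Proof. have := cmod_sqr z; have := cmod_ge0 z; nra. Qed.

Lemma Im_le_cmod z : `|complex.Im z| <= cmod z.
Proof.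
have := cmod_sqr z; have := cmod_ge0 z; have := normr_ge0 (complex.Im z).
have := real_normK (num_real (complex.Im z)); nra.
Qed.

Lemma mulJc z : z * z^* = (cmod z ^+ 2)%:C%C.
Proof. by rewrite cmod_sqr; case: z => a b; apply/eqP; rewrite eq_complex /=; apply/andP; split; apply/eqP; ring. Qed.

Lemma ReJ z : complex.Re z^* = complex.Re z. Proof. by case: z. Qed.

Lemma ReD z w : complex.Re (z + w) = complex.Re z + complex.Re w.
Proof. by case: z w => ? ? []. Qed.

Lemma ReN z : complex.Re (- z) = - complex.Re z. Proof. by case: z. Qed.

Lemma ImN z : complex.Im (- z) = - complex.Im z. Proof. by case: z. Qed.

Lemma ImD z w : complex.Im (z + w) = complex.Im z + complex.Im w.
Proof. by case: z w => ? ? []. Qed.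

Lemma ImJ z : complex.Im z^* = - complex.Im z. Proof. by case: z. Qed.

Lemma Re_rM r z : complex.Re (r%:C%C * z) = r * complex.Re z.
Proof. by case: z => a b /=; rewrite mul0r subr0. Qed.

Lemma Im_rM r z : complex.Im (r%:C%C * z) = r * complex.Im z.
Proof. by case: z => a b /=; rewrite mul0r addr0. Qed.

Lemma ge0_realc z : 0 <= z -> z = (complex.Re z)%:C%C.
Proof. by case: z => a b; rewrite lecE /= => /andP[/eqP -> _]. Qed.

Lemma nonrealP z : nonreal z <-> complex.Im z != 0.
Proof.
rewrite /nonreal -complexIm; split; apply: contra => /eqP; first by move=> ->.
by move=> /complexI ->.
Qed.

Lemma upper_nonreal z : upper_half z -> nonreal z.
Proof. by rewrite /upper_half /nonreal; move=> h; rewrite gt_eqF. Qed.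

Lemma nonrealJ z : nonreal z -> nonreal z^*.
Proof. by move=> /nonrealP h; apply/nonrealP; rewrite ImJ oppr_eq0. Qed.

Lemma small_eq0 z (c : R) : (forall e : R, 0 < e -> cmod z <= c * e) -> z = 0.
Proof.
move=> h; apply: ComplexField.Normc.eq0_normc; apply/eqP.
rewrite eq_le cmod_ge0 andbT leNgt; apply/negP => z0.
have c0 : 0 < c by have := h 1 ltr01; rewrite mulr1; lra.
have /h : 0 < cmod z / (2 * c) by rewrite divr_gt0 // mulr_gt0.
have -> : c * (cmod z / (2 * c)) = cmod z / 2.
  by field; rewrite gt_eqF.
lra.
Qed.

End ComplexModulus.

(** * Semi-inner products *)

Section SemiInner.
Variables (R : realType) (V : lmodType R[i]) (s : V -> V -> R[i]).

Record semi_inner : Prop := SemiInner {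
  siDl : forall x y z, s (x + y) z = s x z + s y z;
  siZl : forall a x z, s (a *: x) z = a * s x z;
  siC : forall x y, s y x = (s x y)^*;
  si_ge0 : forall x, 0 <= s x x }.

(** A real number, so that estimates can be made in the ordered field R; it is
    only a seminorm in general. *)
Definition snorm (x : V) : R := Num.sqrt (complex.Re (s x x)).

Hypothesis hs : semi_inner.
Implicit Types x y z : V.

Lemma siDr x y z : s x (y + z) = s x y + s x z.
Proof. by rewrite (siC hs) (siDl hs) rmorphD /= -!(siC hs). Qed.

Lemma siZr a x y : s x (a *: y) = a^* * s x y.
Proof. by rewrite (siC hs) (siZl hs) rmorphM /= -!(siC hs). Qed.

Lemma siNl x y : s (- x) y = - s x y.
Proof. by rewrite -scaleN1r (siZl hs) mulN1r. Qed.

Lemma siNr x y : s x (- y) = - s x y.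
Proof. by rewrite -scaleN1r siZr rmorphN1 mulN1r. Qed.

Lemma siBl x y z : s (x - y) z = s x z - s y z.
Proof. by rewrite (siDl hs) siNl. Qed.

Lemma siBr x y z : s x (y - z) = s x y - s x z.
Proof. by rewrite siDr siNr. Qed.

Lemma si0l y : s 0 y = 0. Proof. by rewrite -(scale0r 0) (siZl hs) mul0r. Qed.

Lemma si0r y : s y 0 = 0.
Proof. by rewrite (siC hs) si0l rmorph0. Qed.

Lemma si_Re_ge0 x : 0 <= complex.Re (s x x).
Proof. by have := si_ge0 hs x; rewrite lecE /= => /andP[]. Qed.

Lemma snorm_ge0 x : 0 <= snorm x. Proof. exact: sqrtr_ge0. Qed.

Lemma snorm_sqr x : snorm x ^+ 2 = complex.Re (s x x).
Proof. by rewrite sqr_sqrtr // si_Re_ge0. Qed.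

Lemma snormE x : s x x = (snorm x ^+ 2)%:C%C.
Proof. by rewrite snorm_sqr -ge0_realc // (si_ge0 hs). Qed.

Lemma snorm0 : snorm 0 = 0. Proof. by rewrite /snorm si0l sqrtr0. Qed.

Lemma snorm_subZ_sqr a x y : snorm (x - a *: y) ^+ 2
  = snorm x ^+ 2 - 2 * complex.Re (a^* * s x y) + cmod a ^+ 2 * snorm y ^+ 2.
Proof.
rewrite snorm_sqr siBl !siBr siZr !(siZl hs) siZr mulrA mulJc.
rewrite !ReD !ReN !ReD !ReN Re_rM -!snorm_sqr.
have -> : complex.Re (a * s y x) = complex.Re (a^* * s x y).
  by rewrite -ReJ rmorphM /= -(siC hs).
ring.
Qed.

Lemma snormZ a x : snorm (a *: x) = cmod a * snorm x.
Proof.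
apply/eqP; rewrite -(@eqrXn2 _ 2) ?snorm_ge0 ?mulr_ge0 ?cmod_ge0 ?snorm_ge0 //.
rewrite snorm_sqr (siZl hs) siZr mulrA mulJc Re_rM exprMn.
by rewrite snorm_sqr.
Qed.

Lemma snormN x : snorm (- x) = snorm x.
Proof. by rewrite /snorm siNl siNr opprK. Qed.

Lemma snorm_sub x y : snorm (x - y) = snorm (y - x). Proof. by rewrite -snormN opprB. Qed.

(** The square of the seminorm of x - (t (x, y)) y is nonnegative for every real
    t; the vanishing of the seminorm of y is no exception to this argument, as
    the quadratic in t then degenerates to an affine function. *)
Theorem Cauchy_Schwarz x y : cmod (s x y) <= snorm x * snorm y.
Proof.
have key (t : R) : 0 <= snorm x ^+ 2 - 2 * t * cmod (s x y) ^+ 2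
    + t ^+ 2 * cmod (s x y) ^+ 2 * snorm y ^+ 2.
  have := sqr_ge0 (snorm (x - (t%:C%C * s x y) *: y)).
  rewrite snorm_subZ_sqr rmorphM /= -mulrA (mulrC ((s x y)^*)) mulJc.
  rewrite ComplexField.Normc.normcM cmod_real exprMn real_normK ?num_real //.
  have -> : Num.conj (t%:C%C : R[i]) = t%:C%C by exact: conjc_real.
  rewrite Re_rM /=; congr (_ <= _); ring.
rewrite -(@ler_pXn2r _ 2) ?nnegrE ?mulr_ge0 ?snorm_ge0 ?cmod_ge0 //.
rewrite exprMn; set c := cmod _ ^+ 2 in key *.
have c0 : 0 <= c by exact: sqr_ge0.
have := snorm_ge0 y; rewrite le_eqVlt => /orP[/eqP y0|y0].
  rewrite -y0 in key *; rewrite expr0n mulr0.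
  rewrite leNgt; apply/negP => c1.
  have := key ((snorm x ^+ 2 + 1) / c).
  rewrite expr0n /= mulr0 addr0 -!mulrA mulVf ?gt_eqF // mulr1.
  have := sqr_ge0 (snorm x); lra.
have := key ((snorm y ^+ 2)^-1); set d := snorm y ^+ 2.
have d0 : 0 < d by rewrite exprn_gt0.
have -> : snorm x ^+ 2 - 2 * d^-1 * c + d^-1 ^+ 2 * c * d = snorm x ^+ 2 - c / d.
  by field; rewrite gt_eqF.
by rewrite subr_ge0 ler_pdivrMr.
Qed.

Lemma snormD x y : snorm (x + y) <= snorm x + snorm y.
Proof.
rewrite -(@ler_pXn2r _ 2) ?nnegrE ?addr_ge0 ?snorm_ge0 //.
have -> : x + y = x - (-1) *: y by rewrite scaleN1r opprK.
rewrite snorm_subZ_sqr cmodN ComplexField.Normc.normc1 rmorphN rmorph1 mulN1r ReN.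
have := Cauchy_Schwarz x y; have := Re_le_cmod (s x y).
rewrite expr1n mul1r; lra.
Qed.

Lemma snorm_dist x y z : snorm (x - z) <= snorm (x - y) + snorm (y - z).
Proof. by rewrite -(subrKA y); exact: snormD. Qed.

Lemma parallelogram x y :
  snorm (x + y) ^+ 2 + snorm (x - y) ^+ 2 = 2 * snorm x ^+ 2 + 2 * snorm y ^+ 2.
Proof.
rewrite !snorm_sqr !(siDl hs) !siDr !siNl !siNr !ReD !ReN; ring.
Qed.

Lemma si_eq0 x y : snorm x = 0 -> s x y = 0.
Proof.
move=> x0; apply: ComplexField.Normc.eq0_normc; apply/eqP.
rewrite eq_le cmod_ge0 andbT; have := Cauchy_Schwarz x y.
by rewrite x0 mul0r.
Qed.

End SemiInner.

(** * Limits of sequences with respect to a form *)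

Lemma inv_small (R : realType) (e : R) : 0 < e ->
  exists N, forall n, (N <= n)%N -> n.+1%:R^-1 <= e.
Proof.
move=> e0; have := archi_boundP (ltW (_ : 0 < e^-1)).
rewrite invr_gt0 => /(_ e0); set N := Num.bound _ => hN.
exists N => n Nn; rewrite -[e]invrK lef_pV2 ?posrE ?invr_gt0 //.
by rewrite (le_trans (ltW hN)) // ler_nat (leq_trans Nn).
Qed.

Lemma inv_succ_gt0 (R : realType) n : 0 < n.+1%:R^-1 :> R.
Proof. by rewrite invr_gt0. Qed.

(** The complex numbers as a one-dimensional inner product space: limits of
    complex sequences become a special case of [limS]. *)
Definition complex_form (R : realType) (x y : R[i]^o) : R[i] := x * y^*.

Lemma complex_form_semi (R : realType) : semi_inner (@complex_form R).
Proof.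
split=> [x y z|a x z|x y|x]; rewrite /complex_form.
- by rewrite mulrDl.
- by rewrite -mulrA.
- by rewrite rmorphM /= conjCK mulrC.
- by rewrite mulJc ler0c sqr_ge0.
Qed.

Lemma snorm_complex_form (R : realType) (x : R[i]) : snorm (@complex_form R) x = cmod x.
Proof. by rewrite /snorm /complex_form mulJc /= sqrtr_sqr ger0_norm ?cmod_ge0. Qed.

Section Limits.
Variables (R : realType) (V : lmodType R[i]) (s : V -> V -> R[i]).

Definition cauchyS (u : nat -> V) := forall e : R, 0 < e -> exists N,
  forall m n, (N <= m)%N -> (N <= n)%N -> snorm s (u m - u n) <= e.

Definition limS (u : nat -> V) (l : V) := forall e : R, 0 < e -> exists N,
  forall n, (N <= n)%N -> snorm s (u n - l) <= e.

Record hilbert_form : Prop := HilbertForm {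
  hf_semi :> semi_inner s;
  hf_def : forall x, s x x = 0 -> x = 0;
  hf_complete : forall u, cauchyS u -> exists l, limS u l }.

Hypothesis hs : semi_inner s.

Lemma limS_cst l : limS (fun=> l) l.
Proof. by move=> e e0; exists 0%N => n _; rewrite subrr snorm0 // ltW. Qed.

Lemma limS_D u v l m : limS u l -> limS v m -> limS (fun n => u n + v n) (l + m).
Proof.
move=> hu hv e e0; have e2 : 0 < e / 2 by rewrite divr_gt0.
have [N1 h1] := hu _ e2; have [N2 h2] := hv _ e2.
exists (maxn N1 N2) => n; rewrite geq_max => /andP[n1 n2].
rewrite opprD addrACA (le_trans (snormD hs _ _)) //.
by have := h1 _ n1; have := h2 _ n2; lra.
Qed.

Lemma limS_Z a u l : limS u l -> limS (fun n => a *: u n) (a *: l).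
Proof.
move=> hu e e0; have c0 : 0 < cmod a + 1 by rewrite ltr_wpDl // cmod_ge0.
have [N hN] := hu _ (divr_gt0 e0 c0); exists N => n Nn.
rewrite -scalerBr snormZ //; have := hN _ Nn; rewrite ler_pdivlMr //.
have := snorm_ge0 s (u n - l); have := cmod_ge0 a; nra.
Qed.

Lemma limS_cauchy u l : limS u l -> cauchyS u.
Proof.
move=> hu e e0; have [N hN] := hu (e / 2) (divr_gt0 e0 (ltr0Sn _ 1)).
exists N => m n Nm Nn; rewrite (le_trans (snorm_dist hs _ l _)) //.
by have := hN _ Nm; have := hN _ Nn; rewrite (snorm_sub hs (u n)); lra.
Qed.

Lemma limS_bnd u l : limS u l -> exists N, forall n, (N <= n)%N ->
  snorm s (u n) <= snorm s l + 1.
Proof.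
move=> /(_ 1 ltr01)[N hN]; exists N => n Nn; have := hN _ Nn.
by have := snormD hs (u n - l) l; rewrite subrK; lra.
Qed.

Lemma limS_form u v l m : limS u l -> limS v m ->
  forall e : R, 0 < e -> exists N, forall n, (N <= n)%N ->
    cmod (s (u n) (v n) - s l m) <= e.
Proof.
move=> hu hv e e0.
have [N0 h0] := limS_bnd hv.
pose c := snorm s l + snorm s m + 1.
have c0 : 0 < c by rewrite /c; have := snorm_ge0 s l; have := snorm_ge0 s m; lra.
have e2 : 0 < e / (2 * c) by rewrite divr_gt0 // mulr_gt0.
have [N1 h1] := hu _ e2; have [N2 h2] := hv _ e2.
exists (maxn N0 (maxn N1 N2)) => n; rewrite !geq_max => /and3P[n0 n1 n2].
have -> : s (u n) (v n) - s l m = s (u n - l) (v n) + s l (v n - m).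
  by rewrite siBl // siBr //; ring.
apply: le_trans (cmodD _ _) _.
have := Cauchy_Schwarz hs (u n - l) (v n); have := Cauchy_Schwarz hs l (v n - m).
have p1 := ler_pM (snorm_ge0 s _) (snorm_ge0 s _) (h1 _ n1) (h0 _ n0).
have p2 := ler_wpM2l (snorm_ge0 s l) (h2 _ n2).
move: p1 p2 e2; set d := e / _ => p1 p2 d0.
have : e = 2 * (d * c) by rewrite /d; field; rewrite gt_eqF.
have := mulr_gt0 d0 c0; rewrite [in X in 0 < X -> _]/c; rewrite /c; lra.
Qed.

End Limits.

Section HilbertForm.
Variables (R : realType) (V : lmodType R[i]) (s : V -> V -> R[i]).
Hypothesis hs : hilbert_form s.

Lemma snorm_eq0 x : snorm s x = 0 -> x = 0.
Proof. by move=> x0; apply: (hf_def hs); rewrite (snormE hs) x0 expr0n. Qed.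

Lemma hf_inj x y : (forall z, s x z = s y z) -> x = y.
Proof.
by move=> h; apply/eqP; rewrite -subr_eq0; apply/eqP/(hf_def hs); rewrite (siBl hs) h subrr.
Qed.

Lemma hf_injr x y : (forall z, s z x = s z y) -> x = y.
Proof. by move=> h; apply: hf_inj => z; rewrite (siC hs) h -(siC hs). Qed.

End HilbertForm.

Section FormLimits.
Variables (R : realType) (V V' : lmodType R[i]).
Variables (s : V -> V -> R[i]) (s' : V' -> V' -> R[i]).
Hypotheses (hs : semi_inner s) (hs' : semi_inner s').

(** An identity between two inner products passes to limits, also when they
    belong to different spaces; isometries and closed relations are both
    treated in this way. *)
Lemma limS_form_eq u v l m u' v' l' m' : limS s u l -> limS s v m ->
  limS s' u' l' -> limS s' v' m' ->
  (forall n, s (u n) (v n) = s' (u' n) (v' n)) -> s l m = s' l' m'.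
Proof.
move=> hu hv hu' hv' h; apply/eqP; rewrite -subr_eq0; apply/eqP.
apply: (@small_eq0 _ _ 2) => e e0.
have [N1 h1] := limS_form hs hu hv e0; have [N2 h2] := limS_form hs' hu' hv' e0.
have := h1 _ (leq_maxl N1 N2); have := h2 _ (leq_maxr N1 N2); rewrite -h.
set a := s (u _) _; have -> : s l m - s' l' m' = (s l m - a) + (a - s' l' m') by ring.
have := cmodD (s l m - a) (a - s' l' m'); rewrite (cmodB (s l m)); lra.
Qed.

End FormLimits.

(** * Orthogonal projection and the Riesz theorem *)

Section Projection.
Variables (R : realType) (V : lmodType R[i]) (s : V -> V -> R[i]).
Hypothesis hs : hilbert_form s.

Definition subspace (M : set V) := [/\ M 0, (forall x y, M x -> M y -> M (x + y))
  & forall a x, M x -> M (a *: x)].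

Definition seq_closed (M : set V) :=
  forall u l, (forall n, M (u n)) -> limS s u l -> M l.

(** The best choice of a is (z, y) / (y, y), for which the square of the norm
    decreases by |(z, y)|^2 / (y, y). *)
Lemma variation z y : (forall a, snorm s z <= snorm s (z - a *: y)) -> s z y = 0.
Proof.
move=> h; have [y0|y0] := eqVneq (snorm s y) 0.
  by rewrite (siC hs) (si_eq0 hs _ y0) rmorph0.
have yp : 0 < snorm s y by rewrite lt_def y0 snorm_ge0.
apply: ComplexField.Normc.eq0_normc; apply/eqP; rewrite -sqrf_eq0; apply/eqP.
have := h ((snorm s y ^- 2)%:C%C * s z y).
rewrite -(@ler_pXn2r _ 2) ?nnegrE ?snorm_ge0 // (snorm_subZ_sqr hs).
rewrite rmorphM /= -mulrA (mulrC ((s z y)^*)) mulJc.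
have -> : Num.conj ((snorm s y ^- 2)%:C%C : R[i]) = (snorm s y ^- 2)%:C%C by exact: conjc_real.
rewrite Re_rM /= ComplexField.Normc.normcM cmod_real exprMn real_normK ?num_real //.
set c := cmod _ ^+ 2; have c0 : 0 <= c by exact: sqr_ge0.
set d := snorm s y ^+ 2; have d0 : 0 < d by rewrite exprn_gt0.
have -> : d^-1 ^+ 2 * c * d = d^-1 * c by field; rewrite gt_eqF.
have := mulr_ge0 (ltW (_ : 0 < d^-1)) c0; rewrite invr_gt0 => /(_ d0).
move=> h1 h2; have : d^-1 * c = 0 by lra.
by move/eqP; rewrite mulf_eq0 invr_eq0 gt_eqF //= => /eqP.
Qed.

(** A minimizing sequence for the distance is a Cauchy sequence by the
    parallelogram identity, and a nearest point gives an orthogonal difference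
    by [variation]. *)
Theorem projection (M : set V) : subspace M -> seq_closed M ->
  forall x, exists2 m, M m & forall y, M y -> s (x - m) y = 0.
Proof.
move=> [M0 MD MZ] Mcl x.
pose D := [set snorm s (x - m) ^+ 2 | m in M].
have D0 : D !=set0 by exists (snorm s (x - 0) ^+ 2), 0.
have Dlb : has_lbound D by exists 0 => _ [m _ <-]; exact: sqr_ge0.
pose d := inf D.
have dle m : M m -> d <= snorm s (x - m) ^+ 2.
  by move=> Mm; apply: ge_inf => //; exists m.
have /choice[u hu] (n : nat) : exists m, M m /\ snorm s (x - m) ^+ 2 <= d + n.+1%:R^-1.
  have [_ [m Mm <-] hm] := inf_adherent (inv_succ_gt0 R n) (conj D0 Dlb).
  by exists m; split=> //; exact: ltW.
have uM n : M (u n) by have [] := hu n.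
have bnd m n : snorm s (u m - u n) ^+ 2 <= 2 * m.+1%:R^-1 + 2 * n.+1%:R^-1.
  have := parallelogram hs (x - u m) (x - u n).
  have -> : x - u m - (x - u n) = u n - u m by rewrite opprB addrC addrA subrK.
  have -> : x - u m + (x - u n) = 2 *: (x - 2^-1 *: (u m + u n)).
    rewrite scalerBr scalerA mulfV ?pnatr_eq0 // scale1r.
    by rewrite scaler_nat mulr2n opprD addrACA.
  rewrite (snormZ hs) exprMn (snorm_sub hs (u n)).
  have -> : cmod (2 : R[i]) = 2.
    have -> : (2 : R[i]) = (2 : R)%:C%C by rewrite rmorph_nat.
    by rewrite cmod_real ger0_norm.
  have := dle _ (MZ 2^-1 _ (MD _ _ (uM m) (uM n))).
  have [_] := hu m; have [_] := hu n.
  by move: (m.+1%:R^-1) (n.+1%:R^-1) => a b; lra.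
have uc : cauchyS s u.
  move=> e e0; have e4 : 0 < e ^+ 2 / 4 by rewrite divr_gt0 ?exprn_gt0.
  have [N hN] := inv_small e4.
  exists N => m n Nm Nn; rewrite -(@ler_pXn2r _ 2) ?nnegrE ?snorm_ge0 ?(ltW e0) //.
  have := bnd m n; have := hN _ Nm; have := hN _ Nn.
  by move: (m.+1%:R^-1) (n.+1%:R^-1) => a b; lra.
have [l hl] := hf_complete hs uc.
have Ml : M l by exact: Mcl hl.
exists l => // y My; apply: variation => a.
have Mla : M (l + a *: y) by apply: MD => //; exact: MZ.
rewrite -addrA -opprD -(@ler_pXn2r _ 2) ?nnegrE ?snorm_ge0 //.
apply: le_trans (dle _ Mla).
apply/ler_addgt0Pl => e e0.
(* With p and q the distances of x from the limit l and from u n, and r <= 1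
   the distance of u n from l, one has p^2 - q^2 <= r (2 p + 2). *)
pose k := 2 * snorm s (x - l) + 2.
have k0 : 0 < k by rewrite /k; have := snorm_ge0 s (x - l); lra.
have [N1 h1] := inv_small (divr_gt0 e0 (ltr0Sn _ 1) : 0 < e / 2).
have e2 : 0 < Num.min 1 (e / 2 / k) by rewrite lt_min ltr01 !divr_gt0.
have [N2 h2] := hl _ e2.
have := h1 _ (leq_maxl N1 N2); have := h2 _ (leq_maxr N1 N2).
set n := maxn N1 N2; rewrite le_min ler_pdivlMr // => /andP[a1 a2] a3.
have [_ a4] := hu n; move: (n.+1%:R^-1) a3 a4 => t a3 a4.
have a5 := snorm_dist hs x (u n) l.
have a6 := snorm_ge0 s (x - u n); have a7 := snorm_ge0 s (u n - l); have a8 := snorm_ge0 s (x - l).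
have a9 := snorm_dist hs x l (u n); rewrite (snorm_sub hs l) in a9.
rewrite /k in a2.
set p := snorm s (x - l) in a2 a5 a8 a9 *; set q := snorm s (x - u n) in a4 a5 a6 a9.
set r := snorm s (u n - l) in a1 a2 a5 a7 a9.
have : p ^+ 2 - q ^+ 2 <= r * (2 * p + 2).
  have -> : p ^+ 2 - q ^+ 2 = (p - q) * (p + q) by ring.
  have : p + q <= 2 * p + 2 by lra.
  have : p - q <= r by lra.
  nra.
lra.
Qed.

(** The representing vector is a multiple of the component of any vector outside
    the kernel of f that is orthogonal to this kernel. *)
Theorem Riesz (f : V -> R[i]) (c : R) : (forall x y, f (x + y) = f x + f y) ->
  (forall a x, f (a *: x) = a * f x) -> (forall x, cmod (f x) <= c * snorm s x) ->
  exists w, forall x, f x = s x w.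
Proof.
move=> fD fZ fb.
have fB x y : f (x - y) = f x - f y by rewrite fD -scaleN1r fZ mulN1r.
have [f0|/existsNP[x0 fx0]] := pselect (forall x, f x = 0).
  by exists 0 => x; rewrite (si0r hs).
have [||m fm hm] := @projection [set x | f x = 0] _ _ x0.
- split=> [|x y /= fx fy|a x /= fx]; first by rewrite /= -(scale0r 0) fZ mul0r.
  + by rewrite fD fx fy addr0.
  + by rewrite fZ fx mulr0.
- move=> u l /= hu hl; apply: (@small_eq0 _ _ `|c|) => e e0.
  have [N /(_ N (leqnn N))] := hl _ e0.
  have := fb (u N - l); rewrite fB hu sub0r cmodN => h1 h2.
  apply: le_trans h1 _; apply: le_trans (_ : `|c| * snorm s (u N - l) <= _).
    by rewrite ler_wpM2r ?snorm_ge0 // ler_norm.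
  by rewrite ler_wpM2l.
set z := x0 - m in hm; have fz : f z <> 0 by rewrite /z fB fm subr0.
have z0 : s z z != 0.
  by apply/eqP => /(hf_def hs) z0; apply: fz; rewrite z0 -(scale0r 0) fZ mul0r.
exists ((f z / s z z)^* *: z) => x; rewrite (siZr hs) conjCK.
have /hm : f (f z *: x - f x *: z) = 0 by rewrite fB !fZ mulrC subrr.
move=> h; have : s (f z *: x - f x *: z) z = 0 by rewrite (siC hs) h rmorph0.
rewrite (siBl hs) !(siZl hs) => /eqP; rewrite subr_eq0 => /eqP h2.
by rewrite mulrAC h2 mulfK.
Qed.

End Projection.

(** * Adjoints and selfadjoint extensions of linear relations *)

Section Adjoint.
Variables (R : realType) (V : lmodType R[i]) (s : V -> V -> R[i]).
Implicit Types (A B T : set (V * V)).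

(** For the inner product of a sum H + L this is [relation_adjoint]; the general
    form also serves relations in other sums of Hilbert spaces. *)
Definition radj A : set (V * V) :=
  [set p | forall q, A q -> s q.2 p.1 = s q.1 p.2].

Lemma radjS A B : A `<=` B -> radj B `<=` radj A.
Proof. by move=> AB p hp q /AB; exact: hp. Qed.

Hypothesis hs : semi_inner s.

Lemma sub_radjK A : A `<=` radj (radj A).
Proof. by move=> p Ap q /(_ p Ap) h; rewrite (siC hs) -h -(siC hs). Qed.

Lemma radj3 A : radj (radj (radj A)) = radj A.
Proof. by apply/seteqP; split; [apply: radjS|]; exact: sub_radjK. Qed.

Lemma radj_subspace A : subspace (radj A).
Proof.
split=> [q _|p q hp hq r Ar|a p hp r Ar] /=; first by rewrite !(si0r hs).
  by rewrite !(siDr hs) hp // hq.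
by rewrite !(siZr hs) hp.
Qed.

(** The number (x', x) is real for (x, x') in a symmetric relation, so that the
    imaginary part of (x' - z x, x) comes from z alone. *)
Lemma symmetric_bound T p z : T p -> T `<=` radj T ->
  `|complex.Im z| * snorm s p.1 <= snorm s (p.2 - z *: p.1).
Proof.
move=> Tp sT; have h : s p.2 p.1 = s p.1 p.2 by apply: (sT _ Tp).
have I0 : complex.Im (s p.2 p.1) = 0.
  have : complex.Im (s p.2 p.1) = - complex.Im (s p.2 p.1).
    by rewrite -ImJ -(siC hs) h.
  lra.
have : `|complex.Im (s (p.2 - z *: p.1) p.1)| = `|complex.Im z| * snorm s p.1 ^+ 2.
  rewrite (siBl hs) (siZl hs) (snormE hs) (mulrC z) ImD I0 add0r ImN Im_rM.
  by rewrite normrN normrM ger0_norm ?sqr_ge0 // mulrC.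
have := Im_le_cmod (s (p.2 - z *: p.1) p.1).
have := Cauchy_Schwarz hs (p.2 - z *: p.1) p.1.
have [-> _ _ _|p0] := eqVneq (snorm s p.1) 0; first by rewrite mulr0 snorm_ge0.
have pp : 0 < snorm s p.1 by rewrite lt_def p0 snorm_ge0.
by move=> h1 h2 h3; rewrite -(ler_pM2r pp) -mulrA -expr2 -h3 (le_trans h2).
Qed.

End Adjoint.

Section AdjointConstructions.
Variables (R : realType) (V W : lmodType R[i]).
Variables (s : V -> V -> R[i]) (t : W -> W -> R[i]).

Definition pform (x y : V * W) : R[i] := s x.1 y.1 + t x.2 y.2.

Definition dsum_rel (A : set (V * V)) (B : set (W * W)) :
    set ((V * W) * (V * W)) :=
  [set p | A (p.1.1, p.2.1) /\ B (p.1.2, p.2.2)].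

(** Selfadjointness is insensitive to a regrouping of the summands. *)
Lemma radj_pullback (f : V -> W) (B : set (W * W)) :
  (forall y, exists x, f x = y) -> (forall x y, t (f x) (f y) = s x y) ->
  radj t B = B ->
  radj s [set p | B (f p.1, f p.2)] = [set p | B (f p.1, f p.2)].
Proof.
move=> fsurj fis sB; apply/seteqP; split=> p /= hp.
  rewrite -sB => -[y y'] By /=.
  have [x fx] := fsurj y; have [x' fx'] := fsurj y'.
  by rewrite -fx -fx' !fis; apply: (hp (x, x')); rewrite /= fx fx'.
by move=> q /= Bq; rewrite -!fis; move: hp; rewrite -sB => /(_ _ Bq).
Qed.

Hypotheses (hs : semi_inner s) (ht : semi_inner t).

Lemma pform_semi : semi_inner pform.
Proof.
split=> [x y z|a x z|x y|x]; rewrite /pform.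
- by rewrite (siDl hs) (siDl ht) addrACA.
- by rewrite (siZl hs) (siZl ht) mulrDr.
- by rewrite (siC hs) (siC ht) rmorphD.
- by rewrite addr_ge0 // ?(si_ge0 hs) ?(si_ge0 ht).
Qed.

Lemma radj_dsum A B : radj s A = A -> radj t B = B ->
  radj pform (dsum_rel A B) = dsum_rel A B.
Proof.
move=> sA sB; apply/seteqP; split=> -[[x y] [x' y']]; last first.
  by rewrite /dsum_rel /= -{1}sA -{1}sB => -[h1 h2] q [/= /h1 e1 /h2 e2];
    rewrite /pform /= e1 e2.
have [A0 _ _] := radj_subspace hs A; rewrite sA in A0.
have [B0 _ _] := radj_subspace ht B; rewrite sB in B0.
move=> h; split=> /=; [rewrite -sA | rewrite -sB] => -[u u'] Au /=.
  have := h ((u, 0), (u', 0)) (conj Au B0).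
  by rewrite /pform /= !(si0l ht) !addr0.
have := h ((0, u), (0, u')) (conj A0 Au).
by rewrite /pform /= !(si0l hs) !add0r.
Qed.

End AdjointConstructions.

Section Dilation.
Variables (R : realType) (V : lmodType R[i]) (s : V -> V -> R[i]).
Hypothesis hs : semi_inner s.

(** In the coordinates x = a + b, y = a - b of the sum V + V, with x' = a' - b'
    and y' = a' + b', this relation consists of the pairs ((x, y), (y', x'))
    with (x, x') in the adjoint of A and (y, y') in the second adjoint.  It is
    the relation counterpart of the selfadjoint off-diagonal block operator
    whose entries are a closed operator and its adjoint; the change of
    coordinates places the given space V in the first summand. *)
Definition dilation (A : set (V * V)) : set ((V * V) * (V * V)) :=
  [set p | radj s A (p.1.1 + p.1.2, p.2.1 - p.2.2) /\
           radj s (radj s A) (p.1.1 - p.1.2, p.2.1 + p.2.2)].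

Lemma dilation_extends A x x' : A `<=` radj s A -> A (x, x') ->
  dilation A ((x, 0), (x', 0)).
Proof.
move=> sA Ax; split; rewrite /= ?subr0 ?addr0; first exact: sA.
exact: (sub_radjK hs).
Qed.

Lemma radj_dilation A : radj (pform s s) (dilation A) = dilation A.
Proof.
have [S0 SD SZ] := radj_subspace hs A.
have [T0 TD TZ] := radj_subspace hs (radj s A).
apply/seteqP; split=> -[[c d] [c' d']].
  move=> h; split.
    rewrite -(radj3 hs) => v hv /=.
    have /h : dilation A ((v.1, - v.1), (v.2, v.2)).
      by split; rewrite /= ?subrr // opprK; exact: (TD _ _ hv hv).
    by rewrite /pform /= (siNl hs) -(siDr hs) -(siBr hs).
  move=> u hu /=.
  have /h : dilation A ((u.1, u.1), (u.2, - u.2)).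
    by split; rewrite /= ?subrr // opprK; exact: (SD _ _ hu hu).
  by rewrite /pform /= (siNl hs) -(siDr hs) -(siBr hs).
move=> [/= p1 p2] -[[a b] [a' b']] [/= q1 q2]; rewrite /pform /=.
have := p2 _ q1; have := @sub_radjK _ _ _ hs (radj s A) _ p1 _ q2 => /=.
rewrite !(siBl hs) !(siBr hs) !(siDl hs) !(siDr hs) => e1 e2.
have h2 : (2 : R[i]) != 0 by rewrite pnatr_eq0.
apply: (mulfI h2).
have -> : 2 * (s a' c + s b' d) = (s a' c + s a' d + (s b' c + s b' d))
  + (s a' c - s a' d - (s b' c - s b' d)) by ring.
rewrite e1 e2; ring.
Qed.

End Dilation.

Section Resolvent.
Variables (R : realType) (V : lmodType R[i]) (s : V -> V -> R[i]).
Hypothesis hs : hilbert_form s.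
Implicit Types (A B T : set (V * V)) (z w : R[i]).

(** The range is closed because T is closed and [symmetric_bound] controls
    preimages, and a closed subspace with trivial orthogonal complement is the
    whole space. *)
Theorem full_range T B z : T = radj s B -> T `<=` radj s T ->
  complex.Im z != 0 ->
  (forall x, (forall p, T p -> s (p.2 - z *: p.1) x = 0) -> x = 0) ->
  forall k, exists2 p, T p & p.2 - z *: p.1 = k.
Proof.
move=> TB sT z0 ort k.
have [T0 TD TZ] : subspace T by rewrite TB; exact: (radj_subspace hs).
have zp : 0 < `|complex.Im z| by rewrite normr_gt0.
pose M := [set p.2 - z *: p.1 | p in T].
have Msub : subspace M.
  split; first by exists 0 => //=; rewrite scaler0 subr0.
    move=> _ _ [p Tp <-] [q Tq <-]; exists (p + q); first exact: TD.
    by rewrite /= scalerDr opprD addrACA.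
  move=> a _ [p Tp <-]; exists (a *: p); first exact: TZ.
  by rewrite /= scalerBr !scalerA mulrC.
have Mcl : seq_closed s M.
  move=> u l hu ul; have /choice[p hp] : forall n, exists p, T p /\ p.2 - z *: p.1 = u n.
    by move=> n; have [p Tp pu] := hu n; exists p.
  have Tp n : T (p n) by have [] := hp n.
  have pE n : (p n).2 = u n + z *: (p n).1.
    by have [_ <-] := hp n; rewrite subrK.
  have [|y hy] := hf_complete hs (u := fun n => (p n).1).
    move=> e e0; have [N hN] := limS_cauchy hs ul (mulr_gt0 zp e0).
    exists N => m n Nm Nn; rewrite -(ler_pM2l zp).
    apply: le_trans (hN _ _ Nm Nn).
    have Tmn : T (p m - p n) by rewrite -scaleN1r; apply: TD => //; exact: TZ.
    have := symmetric_bound hs z Tmn sT; rewrite /= !pE.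
    rewrite opprD addrACA -scalerBr (_ : u m - u n + _ - _ = u m - u n) //.
    by rewrite addrK.
  have hy2 : limS s (fun n => (p n).2) (l + z *: y).
    under eq_fun do rewrite pE.
    by apply: (limS_D hs) => //; exact: (limS_Z hs).
  exists (y, l + z *: y); last by rewrite /= addrK.
  rewrite TB => q Bq /=.
  apply: (limS_form_eq hs hs (limS_cst hs q.2) hy (limS_cst hs q.1) hy2) => n.
  by have := Tp n; rewrite TB => /(_ q Bq).
have [m [p Tp pm] hm] := projection hs Msub Mcl k.
have /ort/eqP : forall q, T q -> s (q.2 - z *: q.1) (k - m) = 0.
  by move=> q Tq; rewrite (siC hs) hm ?rmorph0 //; exists q.
by rewrite subr_eq0 => /eqP ->; exists p.
Qed.

(** Let T be the second adjoint of A.  Its range at z is the whole space, so every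
    p in the adjoint of A differs from some t in T by an element (d, z d) of the
    adjoint; then d is orthogonal to the range of A at the conjugate of z, and
    d = 0. *)
Theorem essentially_selfadjoint A z : A `<=` radj s A -> complex.Im z != 0 ->
  (forall x, (forall p, A p -> s (p.2 - z *: p.1) x = 0) -> x = 0) ->
  (forall x, (forall p, A p -> s (p.2 - z^* *: p.1) x = 0) -> x = 0) ->
  radj s (radj s A) = radj s A.
Proof.
move=> sA z0 o1 o2; have TS : radj s (radj s A) `<=` radj s A by exact: radjS.
apply/seteqP; split=> // p Sp.
have [_ SD SZ] := radj_subspace hs A.
have [||//||t Tt te] := @full_range (radj s (radj s A)) (radj s A) z _ _ _ _ (p.2 - z *: p.1).
- by [].
- by rewrite (radj3 hs).
- by move=> x hx; apply: o1 => q Aq; apply: hx; exact: (sub_radjK hs).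
have Sd : radj s A (p - t) by rewrite -scaleN1r; apply: SD => //; apply: SZ; exact: TS.
have d2 : p.2 - t.2 = z *: (p.1 - t.1).
  have -> : p.2 = t.2 - z *: t.1 + z *: p.1 by rewrite te subrK.
  by rewrite scalerBr addrAC [t.2 - _]addrC addrK addrC.
have d1 : p.1 - t.1 = 0.
  apply: o2 => q Aq; have := Sd q Aq; rewrite /= d2 (siZr hs).
  by rewrite (siBl hs) (siZl hs) => ->; rewrite subrr.
move: d2; rewrite d1 scaler0 => /eqP; rewrite subr_eq0 => /eqP d2.
by move/eqP: d1; rewrite subr_eq0 => /eqP d1; case: p d1 d2 {Sp te Sd} => p1 p2 /= -> ->; case: t Tt.
Qed.

Section Selfadjoint.
Variable A : set (V * V).
Hypothesis sA : radj s A = A.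

Let A_sub : subspace A. Proof. by rewrite -sA; exact: (radj_subspace hs). Qed.
Let A_sym : A `<=` radj s A. Proof. by rewrite sA. Qed.

(** The resolvent of A at z as a function; its value is meaningful when the
    range of A - z is the whole space, see [resP]. *)
Definition res z k : V := xget 0 [set x | A (x, k + z *: x)].

(** A vector x orthogonal to the range of A - z gives the element (x, z^* x) of
    the adjoint, which is A, and [symmetric_bound] forces x = 0. *)
Lemma resP z k : complex.Im z != 0 -> A (res z k, k + z *: res z k).
Proof.
move=> z0; suff [x Ax] : exists x, A (x, k + z *: x) by have := xgetI 0 (Ax : [set y | A (y, k + z *: y)] x).
have [||//||[x x'] Ax /= xk] := @full_range A A z _ _ _ _ k; rewrite ?sA //.
  move=> x hx; have Ax : A (x, z^* *: x).
    rewrite -sA => p Ap /=; apply/eqP; rewrite (siZr hs) conjCK -subr_eq0.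
    by rewrite -(siZl hs) -(siBl hs) hx.
  have := symmetric_bound hs z^* Ax A_sym; rewrite /= subrr (snorm0 hs).
  rewrite ImJ normrN pmulr_rle0 ?normr_gt0 // => x0; apply: (snorm_eq0 hs).
  by apply/eqP; rewrite eq_le x0 snorm_ge0.
by exists x; rewrite -xk subrK.
Qed.

Lemma res_bound z k : complex.Im z != 0 ->
  `|complex.Im z| * snorm s (res z k) <= snorm s k.
Proof.
by move=> z0; have := symmetric_bound hs z (resP k z0) A_sym; rewrite /= addrK.
Qed.

Lemma res_unique z k x : complex.Im z != 0 -> A (x, k + z *: x) -> res z k = x.
Proof.
move=> z0 Ax; have [_ AD AZ] := A_sub.
have Ad : A ((x, k + z *: x) - (res z k, k + z *: res z k)).
  by rewrite -scaleN1r; apply: AD => //; apply: AZ; exact: resP.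
have := symmetric_bound hs z Ad A_sym.
rewrite /= opprD addrACA subrr add0r scalerBr subrr (snorm0 hs).
rewrite pmulr_rle0 ?normr_gt0 // => x0; apply/eqP.
rewrite eq_sym -subr_eq0; apply/eqP/(snorm_eq0 hs).
by apply/eqP; rewrite eq_le x0 snorm_ge0.
Qed.

Lemma res_linear z a k l : complex.Im z != 0 ->
  res z (a *: k + l) = a *: res z k + res z l.
Proof.
move=> z0; have [_ AD AZ] := A_sub; apply: res_unique => //.
have := AD _ _ (AZ a _ (resP k z0)) (resP l z0); congr (A _).
congr pair => /=; rewrite !scalerDr addrACA; congr (_ + (_ + _)).
by rewrite !scalerA mulrC.
Qed.

Lemma resolvent_identity z w k : complex.Im z != 0 -> complex.Im w != 0 ->
  res z k - res w k = (z - w) *: res z (res w k).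
Proof.
move=> z0 w0; have [_ AD AZ] := A_sub.
apply/eqP; rewrite subr_eq addrC; apply/eqP; apply: res_unique => //.
have := AD _ _ (resP k w0) (AZ (z - w) _ (resP (res w k) z0)); congr (A _).
congr pair => /=; set x := res w k; set y := res z x.
rewrite !scalerDr !scalerA -addrA; congr (_ + _); rewrite addrA; congr (_ + _).
  by rewrite -scalerDl addrC subrK.
by rewrite mulrC.
Qed.

Lemma res_adjoint z k l : complex.Im z != 0 -> s (res z k) l = s k (res z^* l).
Proof.
move=> z0; have zJ : complex.Im z^* != 0 by rewrite ImJ oppr_eq0.
have := A_sym (resP l zJ) (resP k z0) => /=.
rewrite (siDl hs) (siDr hs) (siZl hs) (siZr hs) conjCK.
by move/addIr.
Qed.

End Selfadjoint.
End Resolvent.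

(** * Hilbert spaces and complete inner products *)

Section HilbertSpaces.
Variables (R : realType) (H : hilbertType R).

Lemma hdot_semi : semi_inner (@hdot R H).
Proof.
split=> [x y z|a x z|x y|x].
- exact: linearDl.
- exact: linearZl_LR.
- by rewrite (hermC hdot) expr0 mul1r.
- exact: dnorm_ge0.
Qed.

Lemma hdot_normE (x : H) : `|x| = (snorm hdot x)%:C%C.
Proof.
apply/eqP; rewrite -(@eqrXn2 _ 2) // ?ler0c ?snorm_ge0 //.
by rewrite sqr_norm_hdot (snormE hdot_semi) rmorphXn.
Qed.

Lemma hdot_hilbert : hilbert_form (@hdot R H).
Proof.
split; first exact: hdot_semi.
  by move=> x /eqP; rewrite dnorm_eq0 => /eqP.
move=> u uc.
have /cauchy_cvgP/cvg_ex[l /= ul] : cauchy (u @ \oo).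
  apply: cauchy_exP => e e0; have eE := ge0_realc (ltW e0).
  rewrite eE ltcR in e0.
  have [N hN] := uc _ (divr_gt0 e0 (ltr0Sn _ 1)).
  exists (u N); exists N => // n /= Nn.
  rewrite -ball_normE /ball_ /= eE hdot_normE ltcR.
  by rewrite (le_lt_trans (hN _ _ (leqnn N) Nn)) //; lra.
exists l => e e0; move/cvgrPdist_le : ul => /(_ e%:C%C).
rewrite ltcR => /(_ e0)[N _ hN]; exists N => n Nn.
by have := hN n Nn; rewrite /= hdot_normE lecR (snorm_sub hdot_semi).
Qed.

End HilbertSpaces.

Section HilbertOfForm.
Variables (R : realType) (V : lmodType R[i]) (s : V -> V -> R[i]).

(** A copy of V, needed because V may already carry another norm, as a product
    of two normed modules does. *)
Definition form_space of hilbert_form s : Type := V.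

Variable hs : hilbert_form s.

HB.instance Definition _ := GRing.Lmodule.copy (form_space hs) V.

Definition hnorm (x : form_space hs) : R[i] := (snorm s x)%:C%C.

Lemma hnormD (x y : form_space hs) : hnorm (x + y) <= hnorm x + hnorm y.
Proof. by rewrite /hnorm -rmorphD lecR; exact: (snormD hs). Qed.

Lemma hnormZ (a : R[i]) (x : form_space hs) : hnorm (a *: x) = `|a| * hnorm x.
Proof. by rewrite /hnorm cmodE -rmorphM; congr (_%:C)%C; exact: (snormZ hs). Qed.

Lemma hnorm_eq0 (x : form_space hs) : hnorm x = 0 -> x = 0.
Proof. by move/complexI => x0; exact: (snorm_eq0 hs x0). Qed.

HB.instance Definition _ :=
  @Lmodule_isNormed.Build R[i] (form_space hs) hnorm hnormD hnormZ hnorm_eq0.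

Lemma form_space_normE (x : form_space hs) : `|x| = (snorm s x)%:C%C. Proof. by []. Qed.

Lemma form_space_complete (F : set_system (form_space hs)) :
  ProperFilter F -> cauchy F -> cvg F.
Proof.
move=> FF /cauchyP Fc.
have /choice[u hu] (n : nat) : exists x : V,
    F (ball (x : form_space hs) (n.+1%:R^-1)%:C%C).
  by apply: Fc; rewrite ltcR inv_succ_gt0.
have ballE (x y : V) (e : R) :
    ball (x : form_space hs) e%:C%C (y : form_space hs) -> snorm s (x - y) < e.
  by rewrite -ball_normE /ball_ /= -ltcR.
have uc : cauchyS s u.
  move=> e e0; have e2 : 0 < e / 2 by rewrite divr_gt0.
  have [N hN] := inv_small e2.
  exists N => m n Nm Nn.
  have [y [/ballE h1 /ballE h2]] := filter_ex (filterI (hu m) (hu n)).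
  apply: le_trans (snorm_dist hs (u m) y (u n)) _; rewrite (splitr e) lerD //.
    exact: (ltW (lt_le_trans h1 (hN _ Nm))).
  by rewrite (snorm_sub hs y); exact: (ltW (lt_le_trans h2 (hN _ Nn))).
have [l hl] := hf_complete hs uc.
apply/cvg_ex; exists l; apply/cvgrPdist_le => e e0.
have eE := ge0_realc (ltW e0); rewrite eE ltcR in e0.
have e2 : 0 < complex.Re e / 2 by rewrite divr_gt0.
have [N1 h1] := inv_small e2; have [N2 h2] := hl _ e2.
have a2 := h1 _ (leq_maxl N1 N2); have a1 := h2 _ (leq_maxr N1 N2).
set n := maxn N1 N2 in a1 a2.
apply: filterS (hu n) => y /ballE a3.
rewrite /= eE form_space_normE lecR.
change (snorm s ((l : V) - (y : V)) <= complex.Re e).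
apply: le_trans (snorm_dist hs l (u n) y) _; rewrite (splitr (complex.Re e)) lerD //.
  by rewrite (snorm_sub hs l).
exact: (ltW (lt_le_trans a3 a2)).
Qed.

HB.instance Definition _ := Uniform_isComplete.Build (form_space hs) form_space_complete.

Definition form_space_form (x y : form_space hs) : R[i] := s x y.

Lemma form_space_form_bilinear : bilinear_for
  ( *%R : R[i] -> R[i] -> R[i]) ((Num.conj : R[i] -> R[i]) \; *%R) form_space_form.
Proof.
split=> u a x y; rewrite /form_space_form.
  by rewrite (siDl hs) (siZl hs).
by rewrite (siDr hs) (siZr hs).
Qed.

HB.instance Definition _ := bilinear_isBilinear.Build R[i] (form_space hs) (form_space hs)
  R[i] _ _ form_space_form form_space_form_bilinear.

Lemma form_space_form_herm (x y : form_space hs) :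
  form_space_form x y = (-1) ^+ false * (form_space_form y x)^*.
Proof. by rewrite expr0 mul1r; exact: (siC hs). Qed.

HB.instance Definition _ := isHermitianSesquilinear.Build R[i] (form_space hs)
  false Num.conj form_space_form form_space_form_herm.

Lemma form_space_form_pos (x : form_space hs) : x != 0 -> 0 < form_space_form x x.
Proof.
move=> x0; rewrite lt_def (si_ge0 hs) andbT.
by apply: contra x0 => /eqP /(hf_def hs) ->.
Qed.

HB.instance Definition _ := isDotProduct.Build R[i] (form_space hs) form_space_form
  form_space_form_pos.

Lemma form_space_sqr_norm (x : form_space hs) : `|x| ^+ 2 = form_space_form x x.
Proof. by rewrite form_space_normE -rmorphXn; exact/esym/(snormE hs). Qed.

HB.instance Definition _ := NormedModule_isHilbert.Build R (form_space hs)
  form_space_sqr_norm.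

End HilbertOfForm.

(** * Sums, closed subspaces and completions *)

Section ProductForm.
Variables (R : realType) (V W : lmodType R[i]).
Variables (s : V -> V -> R[i]) (t : W -> W -> R[i]).
Hypotheses (hs : hilbert_form s) (ht : hilbert_form t).

Lemma snorm_pform_sqr x : snorm (pform s t) x ^+ 2 = snorm s x.1 ^+ 2 + snorm t x.2 ^+ 2.
Proof.
by rewrite (snorm_sqr (pform_semi hs ht)) /pform ReD -(snorm_sqr hs) -(snorm_sqr ht).
Qed.

Lemma snorm_pform1 x : snorm s x.1 <= snorm (pform s t) x.
Proof.
rewrite -(@ler_pXn2r _ 2) ?nnegrE ?snorm_ge0 // snorm_pform_sqr.
by rewrite lerDl sqr_ge0.
Qed.

Lemma snorm_pform2 x : snorm t x.2 <= snorm (pform s t) x.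
Proof.
rewrite -(@ler_pXn2r _ 2) ?nnegrE ?snorm_ge0 // snorm_pform_sqr.
by rewrite lerDr sqr_ge0.
Qed.

Lemma snorm_pform_le x : snorm (pform s t) x <= snorm s x.1 + snorm t x.2.
Proof.
rewrite -(@ler_pXn2r _ 2) ?nnegrE ?addr_ge0 ?snorm_ge0 // snorm_pform_sqr sqrrD.
by rewrite addrAC lerDl mulrn_wge0 // mulr_ge0 ?snorm_ge0.
Qed.

Lemma pform_hilbert : hilbert_form (pform s t).
Proof.
split; first exact: (pform_semi hs ht).
  move=> x x0; have : snorm (pform s t) x ^+ 2 = 0.
    by rewrite (snorm_sqr (pform_semi hs ht)) x0.
  rewrite snorm_pform_sqr => /eqP; rewrite paddr_eq0 ?sqr_ge0 // !sqrf_eq0.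
  case: x {x0} => x y /= /andP[/eqP /(snorm_eq0 hs) -> /eqP /(snorm_eq0 ht) ->] //.
move=> u uc.
have [|l1 h1] := hf_complete hs (u := fun n => (u n).1).
  move=> e /uc[N hN]; exists N => m n Nm Nn.
  exact: le_trans (snorm_pform1 (u m - u n)) (hN _ _ Nm Nn).
have [|l2 h2] := hf_complete ht (u := fun n => (u n).2).
  move=> e /uc[N hN]; exists N => m n Nm Nn.
  exact: le_trans (snorm_pform2 (u m - u n)) (hN _ _ Nm Nn).
exists (l1, l2) => e e0; have e2 : 0 < e / 2 by rewrite divr_gt0.
have [N1 g1] := h1 _ e2; have [N2 g2] := h2 _ e2.
exists (maxn N1 N2) => n; rewrite geq_max => /andP[n1 n2].
apply: le_trans (snorm_pform_le _) _; rewrite (splitr e) lerD //.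
  exact: g1.
exact: g2.
Qed.

End ProductForm.

Section SubspaceType.
Variables (R : realType) (V : lmodType R[i]) (M : set V).

Definition mem_subspace : pred V := fun x => `[< M x >].

(** The type depends on a proof that M is a subspace so that its module structure
    can be inferred. *)
Definition subspace_type of subspace M : Type := {x : V | mem_subspace x}.

Variable hM : subspace M.

HB.instance Definition _ :=
  SubChoice.copy (subspace_type hM) {x : V | mem_subspace x}.

Lemma mem_subspace_closed : GRing.subsemimod_closed mem_subspace.
Proof.
have [M0 MD MZ] := hM; split; first split.
- by apply/asboolP.
- by move=> x y /asboolP Mx /asboolP My; apply/asboolP/MD.
- by move=> a x /asboolP Mx; apply/asboolP/MZ.
Qed.

HB.instance Definition _ := GRing.SubChoice_isSubLmodule.Build R[i] V mem_subspace
  (subspace_type hM) mem_subspace_closed.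

Definition subval (x : subspace_type hM) : V := val x.

Lemma subval_linear : linear subval.
Proof. by move=> a x y; rewrite /subval linearP. Qed.

HB.instance Definition _ := GRing.isLinear.Build R[i] (subspace_type hM) V _
  subval subval_linear.

Lemma subval_in x : M (subval x). Proof. by apply/asboolP; exact: valP x. Qed.

Lemma subval_inj : injective subval. Proof. exact: val_inj. Qed.

Lemma subval_surj v : M v -> exists x, subval x = v.
Proof. by move=> Mv; exists (exist _ v (asboolT Mv)). Qed.

Variables (s : V -> V -> R[i]).

Definition subform (x y : subspace_type hM) := s (subval x) (subval y).

Lemma snorm_subform x : snorm subform x = snorm s (subval x). Proof. by []. Qed.

Lemma subform_hilbert : hilbert_form s -> seq_closed s M -> hilbert_form subform.
Proof.
move=> hs Mcl; split.
- split=> [x y z|a x z|x y|x]; rewrite /subform.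
  + by rewrite linearD (siDl hs).
  + by rewrite linearZ (siZl hs).
  + exact: (siC hs).
  + exact: (si_ge0 hs).
- by move=> x /(hf_def hs) x0; apply: subval_inj; rewrite x0 linear0.
- move=> u uc; have [|l hl] := hf_complete hs (u := subval \o u).
    by move=> e /uc[N hN]; exists N => m n Nm Nn; have := hN _ _ Nm Nn;
      rewrite snorm_subform linearB.
  have Ml : M l by apply: Mcl hl => n; exact: subval_in.
  have [x xl] := subval_surj Ml; exists x => e /hl[N hN].
  by exists N => n Nn; have := hN _ Nn; rewrite snorm_subform linearB /= xl.
Qed.

End SubspaceType.

Section ComplexComplete.
Variable R : realType.

Lemma real_complete (a : nat -> R) :
  (forall e, 0 < e -> exists N, forall m n, (N <= m)%N -> (N <= n)%N ->
    `|a m - a n| <= e) ->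
  exists l, forall e, 0 < e -> exists N, forall n, (N <= n)%N -> `|a n - l| <= e.
Proof.
move=> ac; have /cauchy_cvgP/cvg_ex[l /= al] : cauchy ((a : nat -> R^o) @ \oo).
  apply: cauchy_exP => e e0; have [N hN] := ac _ (divr_gt0 e0 (ltr0Sn _ 1)).
  exists (a N); exists N => // n /= Nn; rewrite -ball_normE /ball_ /=.
  by rewrite (le_lt_trans (hN _ _ (leqnn N) Nn)) //; lra.
exists l => e e0; move/cvgrPdist_le : al => /(_ e e0)[N _ hN]; exists N => n Nn.
by have := hN n Nn; rewrite /= distrC.
Qed.

Lemma complex_form_hilbert : hilbert_form (@complex_form R).
Proof.
split; first exact: complex_form_semi.
  move=> x x0; apply: ComplexField.Normc.eq0_normc; rewrite -snorm_complex_form.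
  by rewrite /snorm x0 sqrtr0.
move=> u uc.
have [|a ha] := @real_complete (fun n => complex.Re (u n)).
  move=> e /uc[N hN]; exists N => m n Nm Nn.
  apply: le_trans (hN _ _ Nm Nn); rewrite snorm_complex_form -ReN -ReD.
  have := cmod_sqr (u m - u n); have := cmod_ge0 (u m - u n).
  set z := u m - u n => z0 z2.
  rewrite -(@ler_pXn2r _ 2) ?nnegrE // real_normK ?num_real // z2.
  by rewrite lerDl sqr_ge0.
have [|b hb] := @real_complete (fun n => complex.Im (u n)).
  move=> e /uc[N hN]; exists N => m n Nm Nn.
  apply: le_trans (hN _ _ Nm Nn); rewrite snorm_complex_form -ImN -ImD.
  exact: Im_le_cmod.
exists (Complex a b) => e e0; have e2 : 0 < e / 2 by rewrite divr_gt0.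
have [N1 h1] := ha _ e2; have [N2 h2] := hb _ e2.
exists (maxn N1 N2) => n; rewrite geq_max => /andP[n1 n2].
rewrite snorm_complex_form; have := h1 _ n1; have := h2 _ n2.
set z : R[i] := u n - _.
have -> : complex.Im (u n) - b = complex.Im z by rewrite /z ImD ImN.
have -> : complex.Re (u n) - a = complex.Re z by rewrite /z ReD ReN.
move=> h3 h4; rewrite -(@ler_pXn2r _ 2) ?nnegrE ?cmod_ge0 ?(ltW e0) //.
rewrite cmod_sqr -(real_normK (num_real (complex.Re z))).
rewrite -(real_normK (num_real (complex.Im z))).
have := normr_ge0 (complex.Re z); have := normr_ge0 (complex.Im z); nra.
Qed.

End ComplexComplete.
Section Completion.
Variables (R : realType) (X : lmodType R[i]) (K : X -> X -> R[i]).
Hypothesis hK : semi_inner K.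
Local Notation p := (snorm K).
Local Notation Y := (X -> (R[i] : lmodType R[i])^o).
Implicit Types (f : Y) (g h : X) (e : R) (c : R[i]).

(** The functional f is at distance at most e from (h, . ), in the norm of the
    conjugate-linear functionals on X. *)
Definition approx f e h := forall g, cmod (f g - K h g) <= e * p g.

(** The completion of X is realized inside its antidual: a point is a function f
    that is a limit of the functionals (h, . ).  Distinct functions are distinct
    points, so that no quotient is needed, neither by the kernel of K nor by the
    equivalence of Cauchy sequences. *)
Definition approximable : set Y := [set f | forall e, 0 < e -> exists h, approx f e h].

Lemma approx_form h : approx (K h) 0 h.
Proof. by move=> g; rewrite subrr ComplexField.Normc.normc0 mul0r. Qed.

Lemma approx_mono f d e h : d <= e -> approx f d h -> approx f e h.
Proof. by move=> de fh g; rewrite (le_trans (fh g)) // ler_wpM2r ?snorm_ge0. Qed.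

Lemma approxD f f' e e' h h' : approx f e h -> approx f' e' h' ->
  approx (f + f') (e + e') (h + h').
Proof.
move=> fh fh' g; have -> : (f + f') g - K (h + h') g = (f g - K h g) + (f' g - K h' g).
  by rewrite (siDl hK) opprD addrACA.
by rewrite mulrDl (le_trans (cmodD _ _)) // lerD.
Qed.

Lemma approxZ a f e h : approx f e h -> approx (a *: f) (cmod a * e) (a *: h).
Proof.
move=> fh g; have -> : (a *: f) g - K (a *: h) g = a * (f g - K h g).
  by rewrite (siZl hK) mulrBr.
by rewrite ComplexField.Normc.normcM -mulrA ler_wpM2l ?cmod_ge0.
Qed.

Lemma approximable_form h : approximable (K h).
Proof. by move=> e e0; exists h; apply: approx_mono (ltW e0) (approx_form h). Qed.

Lemma approximable_subspace : subspace approximable.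
Proof.
split.
- move=> e e0; exists 0 => g; rewrite (si0l hK) subr0 ComplexField.Normc.normc0.
  by rewrite mulr_ge0 ?snorm_ge0 ?ltW.
- move=> f f' hf hf' e e0; have e2 : 0 < e / 2 by rewrite divr_gt0.
  have [h fh] := hf _ e2; have [h' fh'] := hf' _ e2; exists (h + h').
  by rewrite (splitr e); exact: approxD.
- move=> a f hf e e0; have c0 : 0 < cmod a + 1 by rewrite ltr_wpDl ?cmod_ge0.
  have [h fh] := hf _ (divr_gt0 e0 c0); exists (a *: h).
  apply: approx_mono (approxZ a fh).
  rewrite mulrA ler_pdivrMr // mulrDr mulr1 mulrC lerDl; exact: ltW.
Qed.

(** The vector h - h' is itself used as the argument of the functionals. *)
Lemma approx_dist f e e' h h' : approx f e h -> approx f e' h' ->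
  0 <= e + e' -> p (h - h') <= e + e'.
Proof.
move=> fh fh' ee; have [->//|h0] := eqVneq (p (h - h')) 0.
have hp : 0 < p (h - h') by rewrite lt_def h0 snorm_ge0.
rewrite -(ler_pM2r hp) -expr2 (snorm_sqr hK); set g := h - h'.
apply: le_trans (Re_le_cmod _) _.
have -> : K g g = (f g - K h' g) - (f g - K h g) by rewrite {1}/g (siBl hK); ring.
apply: le_trans (cmodD _ _) _; rewrite cmodN addrC mulrDl lerD //.
Qed.

Lemma approximable_bound f : approximable f ->
  exists2 B, 0 <= B & forall g, cmod (f g) <= B * p g.
Proof.
move=> /(_ 1 ltr01)[h fh]; exists (1 + p h); first by rewrite addr_ge0 ?snorm_ge0.
move=> g; rewrite -(subrK (K h g) (f g)) (le_trans (cmodD _ _)) // mulrDl.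
by rewrite lerD //; exact: Cauchy_Schwarz.
Qed.

Lemma approximableB f g h : approximable f -> f (g - h) = f g - f h.
Proof.
move=> hf; apply/eqP; rewrite -subr_eq0; apply/eqP.
apply: (@small_eq0 _ _ (p (g - h) + p g + p h)) => e /hf[k fk].
have -> : f (g - h) - (f g - f h)
    = (f (g - h) - K k (g - h)) - (f g - K k g) + (f h - K k h).
  by rewrite (siBr hK); ring.
rewrite mulrC !mulrDr (le_trans (cmodD _ _)) // lerD //.
by rewrite (le_trans (cmodD _ _)) // cmodN lerD.
Qed.

(** The inner product of f and f' is the limit of f(h) when h approaches f'; the
    limit is expressed without choosing a sequence so that it depends on f and
    f' only. *)
Definition limit_along f f' c := forall e, 0 < e -> exists2 d, 0 < d &
  forall h, approx f' d h -> cmod (c - f h) <= e.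

Lemma limit_along_ex f f' : approximable f -> approximable f' -> exists c, limit_along f f' c.
Proof.
move=> hf hf'; have /choice[u hu] (n : nat) := hf' _ (inv_succ_gt0 R n).
have [B B0 fB] := approximable_bound hf.
have dist d n h : 0 < d -> n.+1%:R^-1 <= d -> approx f' d h ->
    cmod (f h - f (u n)) <= B * (2 * d).
  move=> d0 nd f'h; rewrite -approximableB // (le_trans (fB _)) // ler_wpM2l //.
  by rewrite mulr_natl mulr2n (approx_dist f'h (approx_mono nd (hu n))) // addr_ge0 ?ltW.
have small e : 0 < e -> exists2 d, 0 < d & B * (2 * d) <= e.
  move=> e0; have b1 : 0 < 2 * (B + 1) by lra.
  exists (e / (2 * (B + 1))); first by rewrite divr_gt0.
  rewrite mulrA (mulrC B) mulrA ler_pdivrMr //; nra.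
have [|c hc] := hf_complete (complex_form_hilbert R) (u := fun n => f (u n)).
  move=> e /small[d d0 de]; have [N hN] := inv_small d0; exists N => m n Nm Nn.
  rewrite snorm_complex_form (le_trans _ de) //; apply: dist => //; first exact: hN.
  by apply: approx_mono (hu m); exact: hN.
exists c => e e0; have e2 : 0 < e / 2 by rewrite divr_gt0.
have [d d0 de] := small _ e2; exists d => // h f'h.
have [N1 h1] := inv_small d0; have [N2 h2] := hc _ e2.
have a1 := h1 _ (leq_maxl N1 N2); have a2 := h2 _ (leq_maxr N1 N2).
set n := maxn N1 N2 in a1 a2; rewrite snorm_complex_form in a2.
have -> : c - f h = (c - f (u n)) + (f (u n) - f h) by ring.
rewrite (le_trans (cmodD _ _)) // (splitr e) lerD // cmodB //.
exact: le_trans (dist _ _ _ d0 a1 f'h) de.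
Qed.

Lemma limit_along_unique f f' c c' : approximable f' ->
  limit_along f f' c -> limit_along f f' c' -> c = c'.
Proof.
move=> hf' hc hc'; apply/eqP; rewrite -subr_eq0; apply/eqP.
apply: (@small_eq0 _ _ 2) => e e0.
have [d d0 hd] := hc _ e0; have [d' d0' hd'] := hc' _ e0.
have [|h f'h] := hf' (Num.min d d'); first by rewrite lt_min d0.
have a1 : approx f' d h by apply: approx_mono f'h; rewrite ge_min lexx.
have a2 : approx f' d' h by apply: approx_mono f'h; rewrite ge_min lexx orbT.
have -> : c - c' = (c - f h) - (c' - f h) by ring.
rewrite mulr_natl mulr2n (le_trans (cmodD _ _)) // cmodN lerD //; first exact: hd.
exact: hd'.
Qed.

(** An approximant of (h, . ) is close to h in the seminorm, and f is
    continuous. *)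
Lemma limit_along_form f h : approximable f -> limit_along f (K h) (f h).
Proof.
move=> hf e e0; have [B B0 fB] := approximable_bound hf.
have b1 : 0 < B + 1 by lra.
exists (e / (B + 1)); first by rewrite divr_gt0.
move=> h' hh'; rewrite -approximableB //; apply: le_trans (fB _) _.
have := approx_dist (approx_form h) hh'.
rewrite add0r divr_ge0 ?(ltW e0) ?(ltW b1) // => /(_ isT).
by rewrite ler_pdivlMr //; have := snorm_ge0 K (h - h'); nra.
Qed.

Definition dual_form f f' : R[i] := xget 0 (limit_along f f').

Lemma dual_formP f f' : approximable f -> approximable f' -> limit_along f f' (dual_form f f').
Proof. by move=> hf hf'; exact: xgetPex (limit_along_ex hf hf'). Qed.

Lemma dual_formE f f' c : approximable f -> approximable f' -> limit_along f f' c ->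
  dual_form f f' = c.
Proof. by move=> hf hf' hc; apply: (limit_along_unique hf' _ hc); exact: dual_formP. Qed.

Lemma dual_form_eval f h : approximable f -> dual_form f (K h) = f h.
Proof.
by move=> hf; apply: dual_formE => //;[exact: approximable_form|exact: limit_along_form].
Qed.

Lemma dual_formD f1 f2 f : approximable f1 -> approximable f2 -> approximable f ->
  dual_form (f1 + f2) f = dual_form f1 f + dual_form f2 f.
Proof.
move=> h1 h2 hf; have [_ SD _] := approximable_subspace.
apply: dual_formE => //; first exact: SD.
move=> e e0; have e2 : 0 < e / 2 by rewrite divr_gt0.
have [d1 d10 g1] := dual_formP h1 hf e2; have [d2 d20 g2] := dual_formP h2 hf e2.
exists (Num.min d1 d2); first by rewrite lt_min d10.
move=> h fh; rewrite opprD addrACA (splitr e) (le_trans (cmodD _ _)) // lerD //.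
  by apply: g1; apply: approx_mono fh; rewrite ge_min lexx.
by apply: g2; apply: approx_mono fh; rewrite ge_min lexx orbT.
Qed.

Lemma dual_formZ a f f' : approximable f -> approximable f' ->
  dual_form (a *: f) f' = a * dual_form f f'.
Proof.
move=> hf hf'; have [_ _ SZ] := approximable_subspace.
apply: dual_formE => //; first exact: SZ.
move=> e e0; have c0 : 0 < cmod a + 1 by rewrite ltr_wpDl ?cmod_ge0.
have [d d0 g] := dual_formP hf hf' (divr_gt0 e0 c0); exists d => // h /g.
rewrite -mulrBr ComplexField.Normc.normcM ler_pdivlMr //.
by have := cmod_ge0 (dual_form f f' - f h); nra.
Qed.

(** The bound is uniform in the approximants, which lets two limits be taken at
    once. *)
Lemma approx_bounded f : approximable f ->
  exists P, forall d h, 0 < d -> d <= 1 -> approx f d h -> p h <= P.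
Proof.
move=> /(_ 1 ltr01)[h0 fh0]; exists (p h0 + 2) => d h d0 d1 fh.
have := snormD hK (h - h0) h0; rewrite subrK => h1.
have := approx_dist fh fh0; rewrite addr_ge0 ?(ltW d0) // => /(_ isT); lra.
Qed.

Lemma dual_form_approx f f' : approximable f -> approximable f' ->
  forall e, 0 < e -> exists2 d, 0 < d & forall h h', approx f d h -> approx f' d h' ->
    cmod (dual_form f f' - K h h') <= e.
Proof.
move=> hf hf' e e0; have e2 : 0 < e / 2 by rewrite divr_gt0.
have [d d0 g] := dual_formP hf hf' e2.
have [P hP] := approx_bounded hf'.
have P1 : 0 < `|P| + 1 by rewrite ltr_wpDl.
pose d' := Num.min (Num.min 1 d) (e / 2 / (`|P| + 1)).
have d'0 : 0 < d' by rewrite !lt_min ltr01 d0 divr_gt0.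
exists d' => // h h' fh fh'.
have d'1 : d' <= 1 by rewrite !ge_min lexx.
have d'd : d' <= d by rewrite !ge_min lexx orbT.
have -> : dual_form f f' - K h h' = (dual_form f f' - f h') + (f h' - K h h') by ring.
rewrite (splitr e) (le_trans (cmodD _ _)) // lerD //.
  exact/g/(approx_mono d'd fh').
rewrite (le_trans (fh h')) //.
have : d' <= e / 2 / (`|P| + 1) by rewrite !ge_min lexx !orbT.
rewrite ler_pdivlMr //; have := hP _ _ d'0 d'1 fh'.
by have := ler_norm P; have := snorm_ge0 K h'; nra.
Qed.

Lemma dual_formC f f' : approximable f -> approximable f' ->
  dual_form f' f = (dual_form f f')^*.
Proof.
move=> hf hf'; apply/eqP; rewrite -subr_eq0; apply/eqP.
apply: (@small_eq0 _ _ 2) => e e0.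
have [d d0 g] := dual_form_approx hf hf' e0.
have [d' d0' g'] := dual_form_approx hf' hf e0.
have m0 : 0 < Num.min d d' by rewrite lt_min d0.
have [h fh] := hf _ m0; have [h' fh'] := hf' _ m0.
have m1 : Num.min d d' <= d by rewrite ge_min lexx.
have m2 : Num.min d d' <= d' by rewrite ge_min lexx orbT.
have := g _ _ (approx_mono m1 fh) (approx_mono m1 fh').
have := g' _ _ (approx_mono m2 fh') (approx_mono m2 fh).
rewrite -(cmodJ (_ - K h h')) rmorphB /= -(siC hK) => a1 a2.
have -> : dual_form f' f - (dual_form f f')^*
  = (dual_form f' f - K h' h) - ((dual_form f f')^* - K h' h) by ring.
by rewrite mulr_natl mulr2n (le_trans (cmodD _ _)) // cmodN lerD.
Qed.

Lemma dual_form_ge0 f : approximable f -> 0 <= dual_form f f.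
Proof.
move=> hf; rewrite lecE /=; apply/andP; split.
  have : complex.Im (dual_form f f) = - complex.Im (dual_form f f).
    by rewrite -ImJ -dual_formC.
  by move=> h; apply/eqP; lra.
apply/ler_addgt0Pl => e e0; have [d d0 g] := dual_form_approx hf hf e0.
have [h fh] := hf _ d0; have := g _ _ fh fh.
rewrite cmodB => h1; have := le_trans (Re_le_cmod _) h1.
by rewrite ReD ReN; have := si_Re_ge0 hK h; lra.
Qed.

(** For h close to f the number K(h, h) is close to f(h), which is at most e times
    the seminorm of h, so this seminorm is at most about e. *)
Lemma dual_form_le f e : 0 <= e -> approximable f ->
  (forall g, cmod (f g) <= e * p g) -> complex.Re (dual_form f f) <= e ^+ 2.
Proof.
move=> e0 hf fe; apply/ler_addgt0Pl => t t0.
(* The estimate below gives e (e + d0) + t / 2, and d0 (e + 1) <= t / 2. *)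
pose d0 := Num.min 1 (t / 2 / (e + 1)).
have d00 : 0 < d0 by rewrite lt_min ltr01 !divr_gt0 // ltr_wpDl.
have t2 : 0 < t / 2 by rewrite divr_gt0.
have [d1 d10 g] := dual_formP hf hf t2.
have [|h fh] := hf (Num.min d0 d1); first by rewrite lt_min d00.
have fh0 : approx f d0 h by apply: approx_mono fh; rewrite ge_min lexx.
have fh1 : approx f d1 h by apply: approx_mono fh; rewrite ge_min lexx orbT.
have h1 := le_trans (Re_le_cmod _) (g _ fh1); rewrite ReD ReN in h1.
have pe : p h <= e + d0.
  have [->|h0] := eqVneq (p h) 0; first by rewrite addr_ge0 // ltW.
  have hp : 0 < p h by rewrite lt_def h0 snorm_ge0.
  rewrite -(ler_pM2r hp) -expr2 (snorm_sqr hK) mulrDl.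
  have -> : K h h = f h - (f h - K h h) by ring.
  by rewrite (le_trans (Re_le_cmod _)) // (le_trans (cmodD _ _)) // cmodN lerD.
have h2 := le_trans (Re_le_cmod _) (fe h).
have : d0 <= t / 2 / (e + 1) by rewrite ge_min lexx orbT.
rewrite ler_pdivlMr ?ltr_wpDl // => h3.
have h4 := ler_wpM2l e0 pe.
rewrite expr2; nra.
Qed.

Local Notation D := (subspace_type approximable_subspace).

Definition completion_form (f f' : D) : R[i] := dual_form (subval f) (subval f').

Lemma completion_semi : semi_inner completion_form.
Proof.
split=> [x y z|a x z|x y|x]; rewrite /completion_form.
- by rewrite linearD dual_formD //; exact: subval_in.
- by rewrite linearZ dual_formZ //; exact: subval_in.
- by rewrite dual_formC //; exact: subval_in.
- by rewrite dual_form_ge0 //; exact: subval_in.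
Qed.

Lemma embed_ex h : exists f : D, subval f = K h.
Proof. exact/subval_surj/approximable_form. Qed.

Lemma completion_eval (f : D) h (q : D) : subval q = K h ->
  completion_form f q = subval f h.
Proof. by move=> qh; rewrite /completion_form qh dual_form_eval //; exact: subval_in. Qed.

Lemma completion_eval_bound (f : D) h :
  cmod (subval f h) <= snorm completion_form f * p h.
Proof.
have [q qh] := embed_ex h; rewrite -(completion_eval f qh).
apply: le_trans (Cauchy_Schwarz completion_semi _ _) _.
by rewrite /snorm (completion_eval _ qh) qh.
Qed.

(** A Cauchy sequence converges pointwise by [completion_eval_bound], uniformly
    on bounded sets; the limit is approximable because the members of the
    sequence are, and [dual_form_le] turns uniform convergence into convergence
    in norm. *)
Lemma completion_hilbert : hilbert_form completion_form.
Proof.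
split; first exact: completion_semi.
  move=> f f0; apply: subval_inj; rewrite linear0; apply/funext => h.
  apply: ComplexField.Normc.eq0_normc; apply/eqP; rewrite eq_le cmod_ge0 andbT.
  by have := completion_eval_bound f h; rewrite /snorm f0 sqrtr0 mul0r.
move=> u uc.
have /choice[f hf] h : exists l, limS (@complex_form R) (fun n => subval (u n) h) l.
  apply: (hf_complete (complex_form_hilbert R)) => e e0.
  have c0 : 0 < p h + 1 by rewrite ltr_wpDl ?snorm_ge0.
  have [N hN] := uc _ (divr_gt0 e0 c0); exists N => m n Nm Nn; rewrite snorm_complex_form.
  have := completion_eval_bound (u m - u n) h; rewrite linearB => h1.
  rewrite (le_trans h1) //; have := hN _ _ Nm Nn; rewrite ler_pdivlMr //.
  by have := snorm_ge0 completion_form (u m - u n); have := snorm_ge0 K h; nra.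
have subE (x y : D) h : subval (x - y) h = subval x h - subval y h by rewrite linearB.
have fu e : 0 < e -> exists N, forall n, (N <= n)%N -> forall h,
    cmod (subval (u n) h - f h) <= e * p h.
  move=> e0; have [N hN] := uc _ e0; exists N => n Nn h.
  apply/ler_addgt0Pl => t t0; have [N' hN'] := hf h _ t0.
  have := hN' _ (leq_maxr N N'); have := hN _ _ Nn (leq_maxl N N').
  set m := maxn N N'; rewrite snorm_complex_form => h1 h2.
  have h3 := completion_eval_bound (u n - u m) h.
  have -> : subval (u n) h - f h
      = subval (u n - u m) h + (subval (u m) h - f h) by rewrite subE; ring.
  rewrite (le_trans (cmodD _ _)) // addrC lerD //.
  by rewrite (le_trans h3) // ler_wpM2r ?snorm_ge0.
have hfa : approximable f.
  move=> e e0; have e2 : 0 < e / 2 by rewrite divr_gt0.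
  have [N /(_ N (leqnn N)) hN] := fu _ e2.
  have [h uh] := subval_in (u N) _ e2; exists h => g.
  have -> : f g - K h g = (subval (u N) g - K h g) - (subval (u N) g - f g) by ring.
  by rewrite (le_trans (cmodD _ _)) // cmodN (splitr e) mulrDl lerD.
have [l lf] := subval_surj approximable_subspace hfa.
exists l => e e0; have [N hN] := fu _ e0; exists N => n Nn.
rewrite -(@ler_pXn2r _ 2) ?nnegrE ?snorm_ge0 ?(ltW e0) // (snorm_sqr completion_semi).
apply: dual_form_le; [exact: ltW|exact: subval_in|move=> g].
by rewrite linearB /= lf; exact: hN.
Qed.

Theorem completion_exists : exists (H : hilbertType R) (q : {linear X -> H}),
  forall h g, '[< q h, q g >] = K h g.
Proof.
have /choice[q hq] := embed_ex.
pose q' : X -> form_space completion_hilbert := q.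
have qlin : linear q'.
  move=> a x y; apply: (@subval_inj _ _ _ approximable_subspace).
  change (subval (q (a *: x + y)) = subval (a *: q x + q y)).
  rewrite linearP /= !hq; apply/funext => g.
  change (K (a *: x + y) g = a * K x g + K y g).
  by rewrite (siDl hK) (siZl hK).
pose L := GRing.isLinear.Build R[i] X (form_space completion_hilbert) _ q' qlin.
pose Q : {linear X -> form_space completion_hilbert} := HB.pack q' L.
exists (form_space completion_hilbert : hilbertType R), Q => h g.
change (completion_form (q h) (q g) = K h g).
by rewrite (completion_eval _ (hq g)) hq.
Qed.

End Completion.

(** * Extension of isometries by density *)

Lemma linear_bundle (R : realType) (U V : lmodType R[i]) (f : U -> V) :
  linear f -> exists g : {linear U -> V}, forall x, g x = f x.
Proof.
move=> flin; pose L := GRing.isLinear.Build R[i] U V _ f flin.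
by exists (HB.pack f L : {linear U -> V}).
Qed.

Section IsometryExtension.
Variables (R : realType) (X : lmodType R[i]) (H W : hilbertType R).
Variables (hat : {linear X -> H}) (T : {linear X -> W}).

Lemma dense_limS : dense (range hat) ->
  forall x, exists u : nat -> X, limS hdot (fun n => hat (u n)) x.
Proof.
move=> dh x.
have /choice[u hu] (n : nat) : exists h, snorm hdot (hat h - x) <= n.+1%:R^-1.
  have e0 := inv_succ_gt0 R n; set e := n.+1%:R^-1 in e0 *.
  have eC : 0 < e%:C%C :> R[i] by rewrite ltcR.
  have [|y [xh [h _ hy]]] := dh (ball x e%:C%C) _ (ball_open _ _).
    by exists x; exact: ballxx.
  exists h; rewrite -hy in xh; move: xh; rewrite -ball_normE /ball_ /= hdot_normE ltcR => /ltW.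
  by rewrite (snorm_sub (hdot_semi H)).
exists u => e /inv_small[N hN]; exists N => n Nn.
exact: le_trans (hu n) (hN n Nn).
Qed.

(** The closure of the graph of hat h |-> T h is a graph: the inner products of
    its elements agree on both sides, by continuity, and this gives its
    univalence as well as the isometry. *)
Theorem isometry_extension : dense (range hat) ->
  (forall h g, '[< T h, T g >] = '[< hat h, hat g >]) ->
  exists T' : {linear H -> W}, (forall h, T' (hat h) = T h) /\
    forall x y, '[< T' x, T' y >] = '[< x, y >].
Proof.
move=> dh Tis; have hH := hdot_hilbert H; have hW := hdot_hilbert W.
pose G x w := exists u : nat -> X,
  limS hdot (fun n => hat (u n)) x /\ limS hdot (fun n => T (u n)) w.
have Gis x y w z : G x w -> G y z -> '[< w, z >] = '[< x, y >].
  move=> [u [u1 u2]] [v [v1 v2]].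
  exact: (limS_form_eq hW hH u2 v2 u1 v1 (fun n => Tis (u n) (v n))).
have Glin a x y w z : G x w -> G y z -> G (a *: x + y) (a *: w + z).
  move=> [u [u1 u2]] [v [v1 v2]]; exists (fun n => a *: u n + v n); split.
    by under eq_fun do rewrite linearP; apply: (limS_D hH) => //; exact: (limS_Z hH).
  by under eq_fun do rewrite linearP; apply: (limS_D hW) => //; exact: (limS_Z hW).
have Gex x : exists w, G x w.
  have [u ux] := dense_limS dh x.
  have [|w Tw] := hf_complete hW (u := fun n => T (u n)); last by exists w, u.
  move=> e e0; have [N hN] := limS_cauchy hH ux e0; exists N => m n Nm Nn.
  have := hN _ _ Nm Nn; rewrite -!linearB; congr (_ <= _).
  by rewrite /snorm Tis.
have Guniq x w w' : G x w -> G x w' -> w = w'.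
  move=> g g'; apply/eqP; rewrite -subr_eq0; apply/eqP/(hf_def hW).
  have := Glin (-1) _ _ _ _ g' g; rewrite !scaleN1r addNr addrC => h.
  by rewrite (Gis _ _ _ _ h h) (si0l hH).
have /choice[T0 hT0] := Gex.
have [a x y|T' T'E] := @linear_bundle _ _ _ T0.
  by apply: (Guniq (a *: x + y)) => //; exact: Glin.
exists T'; split=> [h|x y]; rewrite !T'E; last exact: Gis.
apply: (Guniq (hat h)) => //; exists (fun=> h).
by split; [exact: (limS_cst hH)|exact: (limS_cst hW)].
Qed.

End IsometryExtension.

(** * Normalized Nevanlinna pairs *)

Section NevanlinnaPairs.
Variables (R : realType) (L : hilbertType R).
Implicit Types (T : {linear L -> L}) (phi psi : opfun L) (z w : R[i]).

Lemma bounded_opP T : bounded_op T ->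
  exists2 c : R, 0 <= c & forall u, snorm hdot (T u) <= c * snorm hdot u.
Proof.
move=> [M hM]; exists (cmod M); first exact: cmod_ge0.
move=> u; rewrite -lecR rmorphM /= -!hdot_normE -cmodE.
apply: le_trans (hM u) _; have := le_trans (normr_ge0 _) (hM u) => h0.
by rewrite -[in leRHS](normr_id u) -normrM ger0_norm.
Qed.

Lemma adjointE T (S : L -> L) v : (forall u, '[< T u, v >] = '[< u, S v >]) ->
  adjoint T v = S v.
Proof.
move=> h; apply: xget_unique => // w hw.
by apply: (hf_injr (hdot_hilbert L)) => u; rewrite -hw h.
Qed.

Lemma adjointP T u v : bounded_op T -> '[< T u, v >] = '[< u, adjoint T v >].
Proof.
move=> /bounded_opP[c c0 hc]; have hL := hdot_hilbert L.
have [|||w hw] := @Riesz _ _ _ hL (fun u => '[< T u, v >]) (c * snorm hdot v).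
- by move=> x y; rewrite linearD (siDl hL).
- by move=> a x; rewrite linearZ (siZl hL).
- move=> x; apply: le_trans (Cauchy_Schwarz hL _ _) _.
  by rewrite mulrAC ler_wpM2r ?snorm_ge0.
by rewrite (@adjointE T (fun=> w)).
Qed.

(** The algebraic content of a normalized pair, common to the pairs given by the
    problem and to those built from a resolvent. *)
Record symmetric_pair phi psi : Prop := SymmetricPair {
  sp_phi : forall z u, nonreal z -> phi z u = z *: psi z u + u;
  sp_adj : forall z u v, nonreal z -> '[< psi z^* u, v >] = '[< u, psi z v >] }.

Section SymmetricPair.
Variables (phi psi : opfun L).
Hypothesis sp : symmetric_pair phi psi.

Lemma sp_adjoint_psi z v : nonreal z -> adjoint (psi z^*) v = psi z v.
Proof. by move=> z0; apply: adjointE => u; exact: (sp_adj sp). Qed.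

Lemma sp_adj_phi z u v : nonreal z -> '[< phi z^* u, v >] = '[< u, phi z v >].
Proof.
move=> z0; have hL := hdot_hilbert L.
rewrite !(sp_phi sp) //; last exact: nonrealJ.
by rewrite (siDl hL) (siDr hL) (siZl hL) (siZr hL) (sp_adj sp).
Qed.

Lemma sp_adjoint_phi z v : nonreal z -> adjoint (phi z^*) v = phi z v.
Proof. by move=> z0; apply: adjointE => u; exact: sp_adj_phi. Qed.

Lemma sp_comm z u : nonreal z -> psi z (phi z u) = phi z (psi z u).
Proof. by move=> z0; rewrite !(sp_phi sp) // linearD linearZ. Qed.

Lemma nkernel0E w z u : nonreal w -> nonreal z ->
  nkernel0 phi psi w z u
  = (z - w^*)^-1 *: (psi z (phi w^* u) - phi z (psi w^* u)).
Proof.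
by move=> w0 z0; rewrite /nkernel0 sp_adjoint_psi // sp_adjoint_phi.
Qed.

End SymmetricPair.

(** Inserting phi(z) = z psi(z) + 1 in the symmetry condition of the pair cancels
    its quadratic terms. *)
Lemma normalized_symmetric phi psi : normalized_nevanlinna_pair phi psi ->
  symmetric_pair phi psi.
Proof.
move=> [[[[bphi _] [bpsi _]] _ sym _] nrm].
have hL := hdot_hilbert L.
have phiE z u : nonreal z -> phi z u = z *: psi z u + u.
  by move=> z0; apply/eqP; rewrite addrC -subr_eq nrm.
split=> // z u v z0; have zJ := nonrealJ z0.
have /eqP := sym z z0 v; rewrite subr_eq0 => /eqP e.
have := adjointP u (phi z v) (bpsi _ zJ); rewrite e -adjointP; last exact: bphi.
rewrite !phiE // (siDl hL) (siDr hL) (siZl hL) (siZr hL).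
by move/addrI.
Qed.

End NevanlinnaPairs.

(** * The pair of a selfadjoint relation *)

Section Holomorphy.
Variables (R : realType) (L : hilbertType R).
Implicit Types (T : {linear L -> L}) (Phi : opfun L) (z h : R[i]).

Lemma bounded_op_bound T (c : R) : (forall u, snorm hdot (T u) <= c * snorm hdot u) ->
  bounded_op T.
Proof.
by move=> h; exists c%:C%C => u; rewrite !hdot_normE -rmorphM lecR.
Qed.

Lemma dnbhs_cmod (x : R[i]) (d : R) : 0 < d ->
  \forall h \near (x : R[i]^o)^', h != x /\ cmod (h - x) < d.
Proof.
move=> d0; have dC : 0 < d%:C%C :> R[i] by rewrite ltcR.
apply: filterS (dnbhs_ball (x : R[i]^o) dC) => h [hb hx].
split; first by apply/eqP.
by move: hb; rewrite -ball_normE /ball_ /= cmodE ltcR cmodB.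
Qed.

(** A remainder of first order in h gives the derivative; this is the bound that
    the resolvent identity provides. *)
Lemma holomorphic_criterion Phi : (forall z, nonreal z -> bounded_op (Phi z)) ->
  (forall z, nonreal z -> exists2 D : {linear L -> L}, bounded_op D &
    exists C d : R, [/\ 0 <= C, 0 < d & forall h, h != 0 -> cmod h < d -> forall u,
      snorm hdot (h^-1 *: (Phi (z + h) u - Phi z u) - D u) <= C * cmod h * snorm hdot u]) ->
  holomorphic Phi.
Proof.
move=> bPhi hPhi; split=> // z z0.
have [D bD [C [d [C0 d0 hD]]]] := hPhi z z0; exists D => // e e0.
have eE := ge0_realc (ltW e0); rewrite eE ltcR in e0 *.
set r := complex.Re e in e0 *.
have C1 : 0 < C + 1 by lra.
have m0 : 0 < Num.min d (r / (C + 1)) by rewrite lt_min d0 divr_gt0.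
apply: filterS (dnbhs_cmod 0 m0) => h; rewrite subr0 lt_min => -[h0 /andP[hd hr]] u.
rewrite !hdot_normE -rmorphM lecR; apply: le_trans (hD h h0 hd u) _.
rewrite ler_wpM2r ?snorm_ge0 //; move: hr; rewrite ltr_pdivlMr //.
by have := cmod_ge0 h; nra.
Qed.

End Holomorphy.

Section ResolventPair.
Variables (R : realType) (E L : hilbertType R) (A : set ((E * L) * (E * L))).
Hypothesis sA : selfadjoint_relation A.
Implicit Types (z w h : R[i]) (u v : L) (f : E) (k : E * L).

Lemma sdot_hilbert : hilbert_form (@sdot R E L).
Proof. exact: (pform_hilbert (hdot_hilbert E) (hdot_hilbert L)). Qed.

Let hS := sdot_hilbert.
Let hE := hdot_hilbert E.
Let hL := hdot_hilbert L.

Lemma selfadjoint_radj : radj (@sdot R E L) A = A.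
Proof. exact: esym sA. Qed.

Let rA := selfadjoint_radj.

Lemma snorm_sdot2 k : snorm hdot k.2 <= snorm (@sdot R E L) k.
Proof. exact: (snorm_pform2 hE hL). Qed.

Lemma snorm_sdot_r u : snorm (@sdot R E L) (0, u) = snorm hdot u.
Proof. by rewrite /snorm /sdot /= (si0l hE) add0r. Qed.

Lemma compressed_resolventE z k v : nonreal z ->
  compressed_resolvent A z (k, v) <-> v = (res A z k).2.
Proof.
move=> /nonrealP z0; split=> [[_ [p Ap <-] /= [<- <-]]|->].
  suff -> : res A z (p.2 - z *: p.1) = p.1 by [].
  by apply: (res_unique hS rA) => //; rewrite subrK; case: p Ap.
exists (k, res A z k) => //; exists (res A z k, k + z *: res A z k).
  exact: (resP hS rA).
by rewrite /= addrK.
Qed.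

Lemma res_lin z a k l : nonreal z -> res A z (a *: k + l) = a *: res A z k + res A z l.
Proof. by move=> /nonrealP; exact: (res_linear hS rA). Qed.

Lemma res_le z k (m : R) : 0 < m -> m <= `|complex.Im z| ->
  snorm (@sdot R E L) (res A z k) <= m^-1 * snorm (@sdot R E L) k.
Proof.
move=> m0 mz; have z0 : complex.Im z != 0 by rewrite -normr_gt0 (lt_le_trans m0).
rewrite mulrC ler_pdivlMr // mulrC (le_trans _ (res_bound hS rA k z0)) //.
by rewrite ler_wpM2r ?snorm_ge0.
Qed.

Lemma res_comp_linear z : nonreal z -> linear (fun u => (res A z (0, u)).2).
Proof.
move=> z0 a u v /=.
have -> : (0, a *: u + v) = a *: (0, u) + (0, v) :> E * L.
  by congr pair => /=; rewrite scaler0 addr0.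
by rewrite res_lin.
Qed.

Lemma res_comp2_linear z : nonreal z -> linear (fun u => (res A z (res A z (0, u))).2).
Proof.
move=> z0 a u v /=.
have -> : (0, a *: u + v) = a *: (0, u) + (0, v) :> E * L.
  by congr pair => /=; rewrite scaler0 addr0.
by rewrite !res_lin.
Qed.

Lemma resolvent_pair_ex : exists phi psi : opfun L, forall z, nonreal z ->
  (forall u, psi z u = (res A z (0, u)).2) /\ (forall u, phi z u = z *: psi z u + u).
Proof.
have /choice[psi hpsi] z : exists T : {linear L -> L}, nonreal z ->
    forall u, T u = (res A z (0, u)).2.
  have [z0|z0] := pselect (nonreal z); last by exists (\0 : {linear L -> L}).
  by have [T hT] := linear_bundle (res_comp_linear z0); exists T.
have /choice[phi hphi] z : exists T : {linear L -> L},
    forall u, T u = z *: psi z u + u.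
  apply: linear_bundle => a u v; rewrite linearP !scalerDr addrACA.
  by rewrite !scalerA mulrC.
by exists phi, psi => z z0; split; [exact: hpsi|exact: hphi].
Qed.

Variables (phi psi : opfun L).
Hypothesis hpsi : forall z u, nonreal z -> psi z u = (res A z (0, u)).2.
Hypothesis hphi : forall z u, nonreal z -> phi z u = z *: psi z u + u.

Lemma resolvent_pair_symmetric : symmetric_pair phi psi.
Proof.
split=> // z u v z0; rewrite !hpsi //; last exact: nonrealJ.
have := res_adjoint hS rA (z := z^*) (0, u) (0, v).
rewrite conjCK /sdot /= (si0l hE) (si0r hE) !add0r; apply.
by apply/nonrealP; exact: nonrealJ.
Qed.

Let sp := resolvent_pair_symmetric.

(** The vector of E representing f |-> (P_L R(w) f, u), where R is the resolvent
    of A, see [kernel_vecP]. *)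
Definition kernel_vec w u : E := (res A w^* (0, u)).1.

Lemma kernel_vecP f w u : nonreal w -> '[< f, kernel_vec w u >] = '[< (res A w (f, 0)).2, u >].
Proof.
move=> /nonrealP w0; have := res_adjoint hS rA (f, 0) (0, u) w0.
by rewrite /sdot /= (si0l hL) (si0r hE) add0r addr0.
Qed.

(** The resolvent identity gives the difference quotient of psi, and the term
    psi(z) psi(w^* ) u removes the component of R(w^* ) u in L. *)
Lemma nkernel0_res w z u : nonreal w -> nonreal z -> z != w^* ->
  nkernel0 phi psi w z u = (res A z (kernel_vec w u, 0)).2.
Proof.
move=> w0 z0 zw; have w0' := nonrealJ w0.
rewrite (nkernel0E sp) // !hphi // linearP.
have ri : psi z u - psi w^* u
    = (z - w^*) *: ((res A z (kernel_vec w u, 0)).2 + psi z (psi w^* u)).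
  rewrite !hpsi //.
  have := resolvent_identity hS rA (0, u) (proj1 (nonrealP _) z0) (proj1 (nonrealP _) w0').
  move/(congr1 snd) => /= ->; congr (_ *: _).
  have {1}-> : res A w^* (0, u) = 1 *: (kernel_vec w u, 0) + (0, (res A w^* (0, u)).2).
    by rewrite /kernel_vec scale1r; case: (res A _ _) => a b; congr pair; rewrite /= ?addr0 ?add0r.
  by rewrite res_lin // scale1r.
have -> : w^* *: psi z (psi w^* u) + psi z u - (z *: psi z (psi w^* u) + psi w^* u)
    = psi z u - psi w^* u - (z - w^*) *: psi z (psi w^* u).
  by rewrite scalerBl opprB opprD addrACA addrC.
by rewrite ri -scalerBr addrK scalerA mulVf ?subr_eq0 // scale1r.
Qed.

Lemma Im_near z h : cmod h < `|complex.Im z| / 2 ->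
  `|complex.Im z| / 2 <= `|complex.Im (z + h)|.
Proof.
move=> hh; have := Im_le_cmod h; rewrite ImD.
have := ler_normB (complex.Im z + complex.Im h) (complex.Im h).
rewrite addrK; lra.
Qed.

Lemma res_continuous z h k : nonreal z -> cmod h < `|complex.Im z| / 2 ->
  snorm (@sdot R E L) (res A (z + h) k - res A z k)
    <= cmod h * (`|complex.Im z| / 2)^-1 ^+ 2 * snorm (@sdot R E L) k.
Proof.
move=> /nonrealP z0 hh; have m0 : 0 < `|complex.Im z| / 2.
  by rewrite divr_gt0 // normr_gt0.
have zh := Im_near hh; set m := _ / 2 in m0 hh zh *.
have zm : m <= `|complex.Im z| by rewrite /m; have := normr_ge0 (complex.Im z); lra.
have zh0 : complex.Im (z + h) != 0 by rewrite -normr_gt0 (lt_le_trans m0).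
rewrite (resolvent_identity hS rA k zh0 z0) (snormZ hS) addrAC subrr add0r.
rewrite -mulrA ler_wpM2l ?cmod_ge0 // expr2 -mulrA.
apply: le_trans (res_le _ m0 zh) _.
by rewrite ler_wpM2l ?invr_ge0 ?(ltW m0) // res_le.
Qed.

(** At z = w^* the kernel is defined as a limit, which exists because the
    resolvent is continuous. *)
Lemma nkernel_res w z u : nonreal w -> nonreal z ->
  nkernel phi psi w z u = (res A z (kernel_vec w u, 0)).2.
Proof.
move=> w0 z0; rewrite /nkernel; case: eqP => [zw|/eqP zw]; last exact: nkernel0_res.
rewrite {}zw in z0 *; set x := w^* in z0 *; set k := (kernel_vec w u, 0).
apply: cvg_lim; first exact: norm_hausdorff.
apply/cvgrPdist_le => e e0; have eE := ge0_realc (ltW e0); rewrite eE ltcR in e0 *.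
set r := complex.Re e in e0 *.
have m0 : 0 < `|complex.Im x| / 2 by rewrite divr_gt0 // normr_gt0; exact/nonrealP.
pose c := (`|complex.Im x| / 2)^-1 ^+ 2 * snorm (@sdot R E L) k.
have c0 : 0 <= c by rewrite mulr_ge0 ?snorm_ge0 ?sqr_ge0.
have c1 : 0 < c + 1 by lra.
have d0 : 0 < Num.min (`|complex.Im x| / 2) (r / (c + 1)) by rewrite lt_min m0 divr_gt0.
apply: filterS (dnbhs_cmod x d0) => l [lx]; rewrite lt_min => /andP[h1 h2].
have lE : x + (l - x) = l by rewrite addrC subrK.
have l0 : nonreal l.
  by apply/nonrealP; rewrite -lE -normr_gt0 (lt_le_trans m0) // Im_near.
rewrite nkernel0_res // hdot_normE lecR -/k (snorm_sub hL).
apply: le_trans (snorm_sdot2 (res A l k - res A x k)) _.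
rewrite -{1}lE; apply: le_trans (res_continuous k z0 h1) _.
rewrite -mulrA -/c; move: h2; rewrite ltr_pdivlMr //.
have := cmod_ge0 (l - x); nra.
Qed.

Lemma resolvent_pair_bounded z : nonreal z -> bounded_op (phi z) /\ bounded_op (psi z).
Proof.
move=> z0; have m0 : 0 < `|complex.Im z| by rewrite normr_gt0; exact/nonrealP.
have hb u : snorm hdot (psi z u) <= `|complex.Im z|^-1 * snorm hdot u.
  rewrite hpsi // -(snorm_sdot_r u); apply: le_trans (snorm_sdot2 _) _.
  exact: res_le.
split; last exact: bounded_op_bound hb.
apply: (@bounded_op_bound _ _ _ (cmod z * `|complex.Im z|^-1 + 1)) => u.
rewrite hphi // mulrDl mul1r (le_trans (snormD hL _ _)) // lerD2r (snormZ hL) -mulrA.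
by rewrite ler_wpM2l ?cmod_ge0.
Qed.

(** The derivative is the compression of the square of the resolvent, and the
    remainder is h times a product of three resolvents. *)
Lemma resolvent_derivative z (D : {linear L -> L}) : nonreal z ->
  (forall u, D u = (res A z (res A z (0, u))).2) ->
  exists C d : R, [/\ 0 <= C, 0 < d & forall h, h != 0 -> cmod h < d -> forall u,
    snorm hdot (h^-1 *: (psi (z + h) u - psi z u) - D u) <= C * cmod h * snorm hdot u /\
    snorm hdot (psi (z + h) u - psi z u) <= C * cmod h * snorm hdot u].
Proof.
move=> z0 hD; have Iz0 := proj1 (nonrealP z) z0.
have m0 : 0 < `|complex.Im z| / 2 by rewrite divr_gt0 // normr_gt0.
set m := _ / 2 in m0 *; have mV : 0 < m^-1 by rewrite invr_gt0.
have zm : m <= `|complex.Im z| by rewrite /m; have := normr_ge0 (complex.Im z); lra.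
exists (m^-1 ^+ 2 * (m^-1 + 1)), m; split=> //.
  by rewrite mulr_ge0 ?sqr_ge0 // addr_ge0 // ltW.
move=> h h0 hm u; have zh := Im_near hm.
have zh0 : complex.Im (z + h) != 0 by rewrite -normr_gt0 (lt_le_trans m0).
have zhn : nonreal (z + h) by apply/nonrealP.
have := snorm_ge0 hdot u; set U := snorm _ u => U0.
have c2 k : snorm hdot (res A (z + h) k - res A z k).2
    <= cmod h * m^-1 ^+ 2 * snorm (@sdot R E L) k.
  exact: le_trans (snorm_sdot2 _) (res_continuous k z0 hm).
have H0 := cmod_ge0 h; rewrite hD !hpsi //; split.
  have := resolvent_identity hS rA (0, u) zh0 Iz0.
  rewrite addrAC subrr add0r => /(congr1 snd) /= ->.
  rewrite scalerA mulVf // scale1r; apply: le_trans (c2 _) _.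
  have := res_le (0, u) m0 zm; rewrite snorm_sdot_r -/U => h1.
  have : m^-1 ^+ 2 * (m^-1 + 1) * cmod h * U
     = cmod h * m^-1 ^+ 2 * (m^-1 * U) + m^-1 ^+ 2 * cmod h * U by ring.
  move=> ->; apply: ler_wpDr; first by rewrite mulr_ge0 // mulr_ge0 // sqr_ge0.
  by rewrite ler_wpM2l // mulr_ge0 // sqr_ge0.
apply: le_trans (c2 _) _; rewrite snorm_sdot_r -/U.
have : m^-1 ^+ 2 * (m^-1 + 1) * cmod h * U
   = cmod h * m^-1 ^+ 2 * U + m^-1 ^+ 2 * m^-1 * cmod h * U by ring.
by move=> ->; rewrite lerDl !mulr_ge0 ?sqr_ge0 // ltW.
Qed.

Lemma resolvent_derivative_bounded z (D : {linear L -> L}) : nonreal z ->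
  (forall u, D u = (res A z (res A z (0, u))).2) -> bounded_op D.
Proof.
move=> z0 hD; have m0 : 0 < `|complex.Im z| by rewrite normr_gt0; exact/nonrealP.
apply: (@bounded_op_bound _ _ _ (`|complex.Im z|^-1 * `|complex.Im z|^-1)) => u.
rewrite hD -(snorm_sdot_r u) -mulrA; apply: le_trans (snorm_sdot2 _) _.
apply: le_trans (res_le _ m0 (lexx _)) _.
by rewrite ler_wpM2l ?invr_ge0 // res_le.
Qed.

Lemma resolvent_psi_holomorphic : holomorphic psi.
Proof.
apply: holomorphic_criterion => [z|z z0]; first by case/resolvent_pair_bounded.
have [D hD] := linear_bundle (res_comp2_linear z0).
exists D; first exact: resolvent_derivative_bounded hD.
have [C [d [C0 d0 h]]] := resolvent_derivative z0 hD.
by exists C, d; split=> // x x0 xd u; have [] := h x x0 xd u.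
Qed.

Lemma resolvent_phi_holomorphic : holomorphic phi.
Proof.
apply: holomorphic_criterion => [z|z z0]; first by case/resolvent_pair_bounded.
have [D hD] := linear_bundle (res_comp2_linear z0).
have [D' hD'] : exists D' : {linear L -> L}, forall u, D' u = z *: D u + psi z u.
  apply: linear_bundle => a u v; rewrite (linearP D) (linearP (psi z)).
  rewrite !scalerDr addrACA.
  by rewrite !scalerA mulrC.
exists D'.
  have [c1 c10 h1] := bounded_opP (resolvent_derivative_bounded z0 hD).
  have [c2 c20 h2] := bounded_opP (proj2 (resolvent_pair_bounded z0)).
  apply: (@bounded_op_bound _ _ _ (cmod z * c1 + c2)) => u.
  rewrite hD' (le_trans (snormD hL _ _)) // mulrDl lerD // (snormZ hL) -mulrA.
  by rewrite ler_wpM2l ?cmod_ge0.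
have [C [d [C0 d0 h]]] := resolvent_derivative z0 hD.
have m0 : 0 < `|complex.Im z| / 2 by rewrite divr_gt0 // normr_gt0; exact/nonrealP.
exists (cmod z * C + C), (Num.min d (`|complex.Im z| / 2)); split.
- by rewrite addr_ge0 // mulr_ge0 ?cmod_ge0.
- by rewrite lt_min d0.
move=> x x0; rewrite lt_min => /andP[xd xm] u; have [h1 h2] := h x x0 xd u.
have zx : nonreal (z + x).
  by apply/nonrealP; rewrite -normr_gt0 (lt_le_trans m0) // Im_near.
set p := psi (z + x) u in h1 h2; set q := psi z u in h1 h2.
have -> : x^-1 *: (phi (z + x) u - phi z u) - D' u
    = z *: (x^-1 *: (p - q) - D u) + (p - q).
  have -> : phi (z + x) u - phi z u = z *: (p - q) + x *: p.
    by rewrite !hphi // opprD addrACA subrr addr0 scalerDl addrAC -scalerBr.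
  rewrite hD' -/q scalerDr !scalerA mulVf // scale1r [in RHS]scalerBr scalerA.
  by rewrite opprD addrACA (mulrC z).
rewrite (le_trans (snormD hL _ _)) // 2!mulrDl lerD // (snormZ hL) -!mulrA.
by rewrite ler_wpM2l ?cmod_ge0 // mulrA.
Qed.

Lemma resolvent_pair_nevanlinna : normalized_nevanlinna_pair phi psi.
Proof.
have nrm z : nonreal z -> forall u, phi z u - z *: psi z u = u.
  by move=> z0 u; rewrite hphi // addrAC subrr add0r.
split=> //; split.
- by split; [exact: resolvent_phi_holomorphic|exact: resolvent_psi_holomorphic].
- move=> n w u hw; have w0 i := upper_nonreal (hw i).
  under eq_bigr => i _.
    under eq_bigr => j _ do rewrite nkernel_res // -kernel_vecP //.
    rewrite -linear_sumr; over.
  rewrite /= -linear_sumlz; exact: (si_ge0 hE).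
- move=> z z0 u; rewrite (sp_adjoint_psi sp) // (sp_adjoint_phi sp) //.
  by rewrite (sp_comm sp) // subrr.
- move=> z z0; exists (idfun : {linear L -> L}); split.
  + by apply: (@bounded_op_bound _ _ _ 1) => u; rewrite mul1r.
  + by move=> u; rewrite nrm.
  + by move=> u; rewrite nrm.
Qed.

End ResolventPair.

(** * The reproducing kernel space of a selfadjoint relation *)

Section ResolventSpace.
Variables (R : realType) (E L : hilbertType R) (A : set ((E * L) * (E * L))).
Hypothesis sA : selfadjoint_relation A.
Variables (phi psi : opfun L).
Hypothesis hpsi : forall z u, nonreal z -> psi z u = (res A z (0, u)).2.
Hypothesis hphi : forall z u, nonreal z -> phi z u = z *: psi z u + u.

Let hE := hdot_hilbert E.
Let hL := hdot_hilbert L.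

(** The orthogonal complement of the vectors g of E whose function
    z |-> P_L R(z) g vanishes, R being the resolvent of A. *)
Definition visible : set E := [set f | forall g,
  (forall z, nonreal z -> (res A z (g, 0)).2 = 0) -> '[< f, g >] = 0].

Lemma visible_subspace : subspace visible.
Proof.
split=> [g _|f f' hf hf' g hg|a f hf g hg]; first exact: (si0l hE).
  by rewrite (siDl hE) hf // hf' // addr0.
by rewrite (siZl hE) hf // mulr0.
Qed.

Lemma visible_closed : seq_closed hdot visible.
Proof.
move=> u l hu ul g hg; rewrite -(si0l hE g).
apply: (limS_form_eq hE hE ul (limS_cst hE g) (limS_cst hE 0) (limS_cst hE g)).
by move=> n; rewrite (si0l hE) hu.
Qed.

Lemma visible_kernel_vec w u : nonreal w -> visible (kernel_vec A w u).
Proof.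
move=> w0 g hg; rewrite (siC hE) (kernel_vecP sA) // hg //.
by rewrite (si0l hL) rmorph0.
Qed.

Let SV := form_space (subform_hilbert visible_subspace hE visible_closed).

Let sv (x : SV) : E := subval (x : subspace_type visible_subspace).

Let sv_linear : linear sv.
Proof. exact: subval_linear. Qed.

(** The visible vectors form the reproducing kernel space: they contain the
    vectors representing the kernel, and a visible vector whose function is zero
    is orthogonal to itself.  The map P is the orthogonal projection; what it
    removes is orthogonal to the kernel vectors, hence has function zero. *)
Lemma resolvent_rkhs_ex : exists (S : rkhs (nkernel phi psi)) (P : E -> S),
  [/\ linear P, forall x, '[< P x, P x >] <= '[< x, x >]
    & forall x z, nonreal z -> ev S z (P x) = (res A z (x, 0)).2].
Proof.
have /choice[evS hev] z : exists T : {linear SV -> L}, nonreal z ->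
    forall x, T x = (res A z (sv x, 0)).2.
  have [z0|z0] := pselect (nonreal z); last by exists (\0 : {linear SV -> L}).
  have [|T hT] := @linear_bundle _ SV L (fun x => (res A z (sv x, 0)).2).
    move=> a x y /=; rewrite sv_linear.
    have -> : (a *: sv x + sv y, 0) = a *: (sv x, 0) + (sv y, 0) :> E * L.
      by congr pair => /=; rewrite scaler0 addr0.
    by rewrite (res_lin sA).
  by exists T.
have dotE (x y : SV) : '[< x, y >] = '[< sv x, sv y >] by [].
have svK x : visible x -> exists y, sv y = x by exact: subval_surj.
have /choice[P hP] x : exists y : SV, forall t : SV, '[< x - sv y, sv t >] = 0.
  have [m /svK[y <-] hm] := projection hE visible_subspace visible_closed x.
  by exists y => t; apply: hm; exact: subval_in.
have Pdot x t : '[< P x, t >] = '[< x, sv t >].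
  by rewrite dotE; have /eqP := hP x t; rewrite (siBl hE) subr_eq0 => /eqP.
have ev_inj' (f g : SV) : (forall z, nonreal z -> evS z f = evS z g) -> f = g.
  move=> fg; apply/eqP; rewrite -subr_eq0; apply/eqP.
  apply: (hf_def (hdot_hilbert SV)); rewrite dotE.
  have sB : sv (f - g) = sv f - sv g by rewrite addrC -scaleN1r sv_linear scaleN1r addrC.
  apply: (subval_in (f - g : subspace_type visible_subspace)) => z z0.
  by rewrite -hev // linearB fg // subrr.
have ev_ker (w : R[i]) (u : L) : nonreal w -> exists k : SV,
    (forall z, nonreal z -> evS z k = nkernel phi psi w z u) /\
    (forall f : SV, '[< f, k >] = '[< evS w f, u >]).
  move=> w0; have [k hk] := svK _ (visible_kernel_vec u w0); exists k; split=> [z z0|f].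
    by rewrite hev // hk (nkernel_res sA hpsi hphi).
  by rewrite dotE hk (kernel_vecP sA) // hev.
exists (Rkhs ev_inj' ev_ker), P; split=> [a x y|x|x z z0] /=.
- apply: (hf_inj (hdot_hilbert SV)) => t.
  by rewrite Pdot (siDl hE) (siZl hE) -!Pdot linearDl linearZl_LR.
- have e : '[< sv (P x), x >] = '[< P x, P x >].
    by rewrite (siC hE x) -Pdot -(siC (hdot_hilbert SV)).
  have := si_ge0 hE (x - sv (P x)).
  by rewrite (siBr hE) hP subr0 (siBl hE) subr_ge0 e.
- rewrite hev //; apply: (hf_inj hL) => u; rewrite -!(kernel_vecP sA) //.
  have [k <-] := svK _ (visible_kernel_vec u z0).
  by have /eqP := hP x k; rewrite (siBl hE) subr_eq0 => /eqP ->.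
Qed.

End ResolventSpace.

(** * The model relation of a normalized pair *)

Section ModelRelation.
Variables (R : realType) (L : hilbertType R) (phi psi : opfun L).
Hypothesis nev : normalized_nevanlinna_pair phi psi.
Variable S : rkhs (nkernel phi psi).

Let sp := normalized_symmetric nev.
Let hS := hdot_hilbert S.
Let hL := hdot_hilbert L.
Let hSL := sdot_hilbert S L.

Definition is_kernel (w : R[i]) (u : L) (k : S) : Prop :=
  (forall z, nonreal z -> ev S z k = nkernel phi psi w z u) /\
  (forall f : S, '[< f, k >] = '[< ev S w f, u >]).

Lemma holomorphic_limS (Phi : opfun L) (z : R[i]) (u : L) : holomorphic Phi ->
  nonreal z -> limS hdot (fun n => Phi (z + (n.+1%:R^-1)%:C%C) u) (Phi z u).
Proof.
move=> [_ /(_ z)] h z0; have [D _ /(_ 1 ltr01) hD] := h z0.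
have {hD} [d /= d0 hD] : exists2 d : R[i], 0 < d & forall h : R[i], `|h| < d -> h != 0 ->
    `|h^-1 *: (Phi (z + h) u - Phi z u) - D u| <= `|u|.
  move: hD => /nbhs_ballP[d d0 hD]; exists d => // x xd x0.
  rewrite -[leRHS]mul1r; apply: hD => //.
  by rewrite -ball_normE /ball_ /= sub0r normrN.
have dE := ge0_realc (ltW d0); rewrite dE ltcR in d0.
set C := snorm hdot (D u) + snorm hdot u + 1.
have C0 : 0 < C by rewrite /C; have := snorm_ge0 hdot (D u); have := snorm_ge0 hdot u; lra.
move=> e e0; have m0 : 0 < Num.min (complex.Re d / 2) (e / C).
  by rewrite lt_min !divr_gt0.
have [N hN] := inv_small m0; exists N => n /hN; rewrite le_min.
have := inv_succ_gt0 R n; set t := n.+1%:R^-1 => t0 /andP[td te].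
have tC : t%:C%C != 0 :> R[i] by apply: contraTneq t0 => /complexI ->; rewrite ltxx.
have tn : `|t%:C%C| < d by rewrite cmodE cmod_real gtr0_norm // dE ltcR; lra.
have := hD _ tn tC; rewrite !hdot_normE lecR; set q := _ *: _ => hq.
have -> : Phi (z + t%:C%C) u - Phi z u = t%:C%C *: q by rewrite scalerA mulfV // scale1r.
rewrite (snormZ hL) cmod_real gtr0_norm //.
have := snormD hL (q - D u) (D u); rewrite subrK => h1.
move: te; rewrite ler_pdivlMr //; apply: le_trans.
by rewrite ler_wpM2l ?(ltW t0) // /C; lra.
Qed.

Lemma form_cvg (V : lmodType R[i]) (s : V -> V -> R[i]) u v l m : semi_inner s ->
  limS s u l -> limS s v m ->
  (fun n => s (u n) (v n) : R[i]^o) @ \oo --> (s l m : R[i]^o).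
Proof.
move=> hs hu hv; apply/cvgrPdist_le => e e0; have eE := ge0_realc (ltW e0).
rewrite eE ltcR in e0; have [N hN] := limS_form hs hu hv e0; exists N => // n /= Nn.
by rewrite eE cmodE lecR cmodB; exact: hN.
Qed.

(** Away from z = w^* the inner product of kernel functions is an expression in
    values of phi and psi, whose continuity can be used. *)
Lemma kernel_dot w z u k l : nonreal w -> nonreal z -> z != w^* ->
  is_kernel w u k -> is_kernel z u l ->
  '[< k, l >] = (z - w^*)^-1 *
    ('[< phi w^* u, psi z^* u >] - '[< psi w^* u, phi z^* u >]).
Proof.
move=> w0 z0 zw [hk _] [_ ->]; rewrite hk // /nkernel (negbTE zw) (nkernel0E sp) //.
rewrite (siZl hL) (siBl hL); congr (_ * (_ - _)).
  by rewrite -(sp_adj sp) ?conjCK //; exact: nonrealJ.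
by rewrite -(sp_adj_phi sp) ?conjCK //; exact: nonrealJ.
Qed.

(** The kernel functions depend continuously on the point, so that the functions
    of the space do too: f is orthogonal to the kernel functions at the points
    mu + 1/(n + 1), which converge to the kernel function at mu. *)
Lemma ev_isolated (f : S) (mu : R[i]) : nonreal mu ->
  (forall w, nonreal w -> w != mu -> ev S w f = 0) -> ev S mu f = 0.
Proof.
move=> mu0 hf; apply: (hf_inj hL) => v; rewrite (si0l hL).
have Imu := proj1 (nonrealP _) mu0.
pose t n : R[i] := (n.+1%:R^-1)%:C%C.
pose w n := mu + t n.
have ImW n : complex.Im (w n) = complex.Im mu by rewrite /w ImD /= addr0.
have w0 n : nonreal (w n) by apply/nonrealP; rewrite ImW.
have wmu n : w n != mu.
  rewrite /w -subr_eq0 addrAC subrr add0r.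
  by apply: contraTneq (inv_succ_gt0 R n) => /complexI ->; rewrite ltxx.
(* The increments are real, so that the points w n stay in the half-plane of
   mu and conjugation preserves them. *)
have tJ n : (t n)^* = t n by exact: conjc_real.
have wJ n : (w n)^* = mu^* + t n by rewrite /w rmorphD /= tJ.
have [k hk] := ev_kernel S v mu0.
have /choice[kn hkn] n := ev_kernel S v (w0 n).
have [_ hk2] := hk; rewrite -hk2.
have half (x y : R[i]) : complex.Im x = complex.Im mu -> complex.Im y = complex.Im mu ->
    x != y^*.
  move=> hx hy; apply/eqP => /(congr1 (@complex.Im R)); rewrite ImJ hx hy => h.
  by move/eqP: Imu; apply; lra.
have lb : limS hdot (fun n => psi (mu^* + t n) v) (psi mu^* v).
  by apply: holomorphic_limS; [have [[[]]] := nev|exact: nonrealJ].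
have lc : limS hdot (fun n => phi (mu^* + t n) v) (phi mu^* v).
  by apply: holomorphic_limS; [have [[[]]] := nev|exact: nonrealJ].
set b := psi mu^* v in lb; set c := phi mu^* v in lc.
pose bn n := psi (mu^* + t n) v; pose cn n := phi (mu^* + t n) v.
pose D := mu - mu^*.
have D0 : D != 0 by rewrite subr_eq0 half.
pose e n : R[i]^o := D^-1 * ('[< cn n, bn n >] - '[< bn n, cn n >])
  - (D - t n)^-1 * ('[< cn n, b >] - '[< bn n, c >])
  - (D + t n)^-1 * ('[< c, bn n >] - '[< b, cn n >])
  + D^-1 * ('[< c, b >] - '[< b, c >]).
have eE n : '[< kn n - k, kn n - k >] = e n.
  rewrite (siBl hS) !(siBr hS).
  rewrite (kernel_dot _ _ _ (hkn n) (hkn n)) ?half //.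
  rewrite (kernel_dot _ _ _ (hkn n) hk) ?half //.
  rewrite (kernel_dot _ _ _ hk (hkn n)) ?half //.
  rewrite (kernel_dot _ _ _ hk hk) ?half // /e !wJ -/b -/c -/(bn n) -/(cn n).
  have -> : w n - (mu^* + t n) = D by rewrite /w /D; ring.
  have -> : mu - (mu^* + t n) = D - t n by rewrite /D; ring.
  have -> : w n - mu^* = D + t n by rewrite /w /D; ring.
  rewrite -/D; ring.
have e_cvg : e @ \oo --> (0 : R[i]^o).
  have t_cvg : (fun n => t n : R[i]^o) @ \oo --> (0 : R[i]^o).
    apply/cvgrPdist_le => r r0; have rE := ge0_realc (ltW r0); rewrite rE ltcR in r0.
    have [N hN] := inv_small r0; exists N => // n /= Nn.
    by rewrite sub0r normrN rE cmodE lecR cmod_real gtr0_norm ?inv_succ_gt0 // hN.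
  have lb0 := limS_cst hL b; have lc0 := limS_cst hL c.
  have Dm : (fun n => D - t n : R[i]^o) @ \oo --> (D : R[i]^o).
    have h := cvgB (cvg_cst (D : R[i]^o)) t_cvg; rewrite subr0 in h; exact: h.
  have Dp : (fun n => D + t n : R[i]^o) @ \oo --> (D : R[i]^o).
    have h := cvgD (cvg_cst (D : R[i]^o)) t_cvg; rewrite addr0 in h; exact: h.
  have iDm : (fun n => (D - t n)^-1 : R[i]^o) @ \oo --> (D^-1 : R[i]^o).
    exact: (@cvgV R[i] nat \oo _ (fun n => D - t n) D D0 Dm).
  have iDp : (fun n => (D + t n)^-1 : R[i]^o) @ \oo --> (D^-1 : R[i]^o).
    exact: (@cvgV R[i] nat \oo _ (fun n => D + t n) D D0 Dp).
  have c1 := cvgM (cvg_cst (D^-1 : R[i]^o))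
    (cvgB (form_cvg hL lc lb) (form_cvg hL lb lc)).
  have c2 := cvgM iDm (cvgB (form_cvg hL lc lb0) (form_cvg hL lb lc0)).
  have c3 := cvgM iDp (cvgB (form_cvg hL lc0 lb) (form_cvg hL lb0 lc)).
  have FF : Filter (\oo : set_system nat) by exact: eventually_filter.
  pose G : R[i]^o := D^-1 * ('[< c, b >] - '[< b, c >]).
  have -> : (0 : R[i]^o) = G - G - G + G by rewrite subrr sub0r addNr.
  exact: (@cvgD _ _ _ _ FF _ _ _ _ (@cvgB _ _ _ _ FF _ _ _ _ (@cvgB _ _ _ _ FF _ _ _ _
    (c1 FF FF FF) (c2 FF FF)) (c3 FF FF)) (@cvg_cst _ G nat \oo FF)).
apply: (@small_eq0 _ _ (snorm hdot f)) => r r0.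
have r2 : 0 < (r ^+ 2)%:C%C :> R[i] by rewrite ltcR exprn_gt0.
move/cvgrPdist_le : e_cvg => /(_ _ r2)[N _ /(_ N (leqnn N))].
rewrite sub0r normrN -eE (snormE hS) cmodE lecR cmod_real ger0_norm ?sqr_ge0 //.
rewrite (@ler_pXn2r _ 2) ?nnegrE ?snorm_ge0 ?(ltW r0) // => hr.
have -> : '[< f, k >] = - '[< f, kn N - k >].
  by rewrite (siBr hS) (proj2 (hkn N)) hf // (si0l hL) sub0r opprK.
rewrite cmodN; apply: le_trans (Cauchy_Schwarz hS _ _) _.
by rewrite ler_wpM2l ?snorm_ge0.
Qed.

(** A resolvent with compression psi whose visible part is S maps (0, u) to
    (k, psi(w^* ) u) at w^*; these are the corresponding elements of the
    relation. *)
Definition kernel_graph : set ((S * L) * (S * L)) := [set p | exists w u k,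
  [/\ nonreal w, is_kernel w u k
    & p = ((k, psi w^* u), (w^* *: k, phi w^* u))]].

Definition model : set ((S * L) * (S * L)) := radj (@sdot R S L) kernel_graph.

(** By the reproducing property, orthogonality to the kernel functions of all
    points is an equation between values of functions. *)
Lemma modelP p : model p <-> forall z, nonreal z ->
  ev S z p.2.1 - z *: ev S z p.1.1 = phi z p.1.2 - psi z p.2.2.
Proof.
case: p => -[f v] [f' v'] /=.
have key w u k : nonreal w -> is_kernel w u k ->
    sdot (w^* *: k, phi w^* u) (f, v) = sdot (k, psi w^* u) (f', v') <->
    '[< u, w *: ev S w f + phi w v >] = '[< u, ev S w f' + psi w v' >].
  move=> w0 [_ hk]; rewrite /sdot /= (siZl hS) !(siDr hL) (siZr hL).
  rewrite (sp_adj_phi sp) // (sp_adj sp) //.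
  by rewrite (siC hS f) (siC hS f') !hk -!(siC hL).
have eqv (a b c d : L) : a + b = c + d <-> c - a = b - d.
  split=> h.
    have -> : c = a + b - d by rewrite h addrK.
    by rewrite addrAC [a + b]addrC addrK.
  have -> : c = b - d + a by rewrite -h subrK.
  by rewrite addrAC subrK addrC.
split=> [h z z0|h q [w [u [k [w0 hk ->]]]]].
  apply: (proj1 (eqv _ _ _ _)); apply: (hf_injr hL) => u; have [k hk] := ev_kernel S u z0.
  apply: (proj1 (key z u k z0 hk)).
  apply: (h ((k, psi z^* u), (z^* *: k, phi z^* u))).
  by exists z, u, k.
by apply: (proj2 (key w u k w0 hk)); rewrite (proj2 (eqv _ _ _ _) (h w w0)).
Qed.

Lemma kernel_graph_model : kernel_graph `<=` model.
Proof.
move=> p [w [u [k [w0 [hk _] ->]]]]; apply/modelP => z z0 /=.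
rewrite linearZ /= -scalerBl hk // /nkernel; case: eqP => [->|/eqP zw].
  by rewrite subrr scale0r (sp_comm sp) ?subrr //; exact: nonrealJ.
rewrite (nkernel0E sp) // scalerA -opprB mulNr mulfV ?subr_eq0 // scaleN1r.
by rewrite opprB.
Qed.

(** The point w with w^* = mu shows that the component in L is zero; the other
    points show that f vanishes outside mu^*, and then it vanishes everywhere by
    [ev_isolated]. *)
Lemma kernel_graph_total (mu : R[i]) x : nonreal mu ->
  (forall p, kernel_graph p -> sdot (p.2 - mu *: p.1) x = 0) -> x = 0.
Proof.
move=> mu0 hx; have muJ := nonrealJ mu0; case: x hx => f v hx.
have v0 : v = 0.
  apply: (hf_injr hL) => u; rewrite (si0r hL).
  have [k hk] := ev_kernel S u muJ.
  have : kernel_graph ((k, psi mu u), (mu *: k, phi mu u)).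
    by exists mu^*, u, k; rewrite conjCK.
  move=> /hx; rewrite /sdot /= subrr (si0l hS) add0r (sp_phi sp) //.
  by rewrite addrAC subrr add0r.
have fw w : nonreal w -> w != mu^* -> ev S w f = 0.
  move=> w0 wmu; apply: (hf_injr hL) => u; rewrite (si0r hL).
  have [k hk] := ev_kernel S u w0.
  have := hx ((k, psi w^* u), (w^* *: k, phi w^* u)).
  rewrite v0 /sdot /= (si0r hL) addr0 -scalerBl (siZl hS) => h.
  have : (w^* - mu) * '[< k, f >] = 0 by apply: h; exists w, u, k.
  move/eqP; rewrite mulf_eq0 subr_eq0 => /orP[/eqP wJ|/eqP kf].
    by move: wmu; rewrite -wJ conjCK eqxx.
  by rewrite (siC hL) -(proj2 hk) (siC hS) kf !rmorph0.
congr pair => //; apply: (@ev_inj _ _ _ S) => z z0; rewrite linear0.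
have [->|zm] := eqVneq z mu^*; last exact: fw.
exact: ev_isolated.
Qed.

Theorem model_selfadjoint : radj (@sdot R S L) model = model.
Proof.
have i0 : complex.Im (Complex 0 1 : R[i]) != 0 by rewrite /= oner_eq0.
have in0 : nonreal (Complex 0 1 : R[i]) by apply/nonrealP.
apply: (essentially_selfadjoint hSL kernel_graph_model i0) => x.
  exact: kernel_graph_total.
by apply: kernel_graph_total; exact: nonrealJ.
Qed.

End ModelRelation.

(** * From extensions to solutions *)

Section ProblemForms.
Variables (R : realType) (X : lmodType R[i]) (L : hilbertType R).
Variable K : {bilinear X -> X -> R[i] | *%R & (Num.conj : R[i] -> R[i]) \; *%R}.
Hypothesis K_ge0 : forall h : X, 0 <= K h h.

(** Hermitian symmetry follows from nonnegativity by polarization, as K is real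
    at x + y and at x + i y. *)
Lemma bilinear_semi_inner : semi_inner K.
Proof.
split=> [x y z|a x z|x y|//]; [exact: linearDl|exact: linearZl_LR|].
have KI h : complex.Im (K h h) = 0 by exact: ger0_Im.
have e1 : complex.Im (K x y) + complex.Im (K y x) = 0.
  have := KI (x + y); rewrite linearDl !linearDr /= !ImD !KI; lra.
have e2 : complex.Re (K y x) = complex.Re (K x y).
  pose j : R[i] := Complex 0 1.
  have := KI (x + j *: y).
  rewrite linearDl !linearDr linearZl_LR !linearZr_LR /= linearZl_LR /=.
  rewrite !ImD KI !mulrA.
  case: (K x y) (K y x) (K y y) (KI y) => a b [c d] [e f] /= -> ; lra.
move: e1 e2; case: (K x y) (K y x) => a b [c d] /= e1 e2.
by apply/eqP; rewrite eq_complex /= e2 eqxx /=; apply/eqP; lra.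
Qed.

End ProblemForms.

Section Correspondence.
Variables (R : realType) (X : lmodType R[i]) (L : hilbertType R).
Variables (B1 B2 : {linear X -> X}) (C1 C2 : {linear X -> L}).
Variable K : {bilinear X -> X -> R[i] | *%R & (Num.conj : R[i] -> R[i]) \; *%R}.
Variables (H : hilbertType R) (hat : {linear X -> H}).
Hypothesis hatK : forall h g, '[< hat h, hat g >] = K h g.

Lemma param_formulaE (E : sa_extension_with_exit B1 B2 C1 C2 hat)
    (phi psi : opfun L) : param_formula E phi psi <->
  forall z, nonreal z -> (forall u, psi z u = (res (exit_rel E) z (0, u)).2) /\
    (forall u, phi z u = z *: psi z u + u).
Proof.
have sA := exit_rel_selfadjoint E.
split=> h z z0; have [h1 h2] := h z z0; split=> // u.
  by apply/(compressed_resolventE sA _ _ z0)/h1.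
move=> v; split=> [<-|/(compressed_resolventE sA _ _ z0) ->]; last exact: h1.
exact/(compressed_resolventE sA _ _ z0).
Qed.

Theorem extension_gives_solution (E : sa_extension_with_exit B1 B2 C1 C2 hat)
    (phi psi : opfun L) : param_formula E phi psi ->
  normalized_nevanlinna_pair phi psi /\
  exists (S : rkhs (nkernel phi psi)) (F : {linear X -> S}),
    aip_mapping B1 B2 C1 C2 K F /\ mapping_formula E F.
Proof.
move=> /param_formulaE hE; have sA := exit_rel_selfadjoint E.
have hpsi z u : nonreal z -> psi z u = (res (exit_rel E) z (0, u)).2.
  by move=> z0; have [->] := hE z z0.
have hphi z u : nonreal z -> phi z u = z *: psi z u + u.
  by move=> z0; have [_ ->] := hE z z0.
split; first exact: (resolvent_pair_nevanlinna sA hpsi hphi).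
have [S [P [Plin Pnorm Pev]]] := resolvent_rkhs_ex sA hpsi hphi.
have [|F hF] := @linear_bundle _ X S (fun h => P (exit_incl E (hat h))).
  by move=> a x y; rewrite linearP linearP Plin.
have Fev z h : nonreal z ->
    ev S z (F h) = (res (exit_rel E) z (exit_incl E (hat h), 0)).2.
  by move=> z0; rewrite hF Pev.
exists S, F; split; last first.
  move=> h z z0 v; rewrite Fev //.
  by split=> [<-|/(compressed_resolventE sA _ _ z0) ->//]; exact/compressed_resolventE.
split=> [h z z0|h]; last first.
  rewrite sqr_norm_hdot hF -hatK -(exit_incl_isometry E); exact: Pnorm.
rewrite !Fev // hphi // !hpsi //.
have Ap : exit_rel E ((exit_incl E (hat (B1 h)), C1 h), (exit_incl E (hat (B2 h)), C2 h)).
  by apply: exit_rel_extends; exists h.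
set x1 := exit_incl E _ in Ap *; set x2 := exit_incl E _ in Ap *.
set r := res (exit_rel E) z.
have rlin a k l : r (a *: k + l) = a *: r k + r l by exact: (res_lin sA).
have rA : r ((x2, C2 h) - z *: (x1, C1 h)) = (x1, C1 h).
  apply: (res_unique (sdot_hilbert _ _) (selfadjoint_radj sA)); first exact/nonrealP.
  by rewrite subrK.
have e1 : (x2, C2 h) - z *: (x1, C1 h)
    = (- z) *: (x1, 0) + ((- z) *: (0, C1 h) + (1 *: (x2, 0) + (0, C2 h))).
  by congr pair; rewrite /= !scaler0 ?scaleNr ?scale1r ?add0r ?addr0 // addrC.
move: rA; rewrite e1 !rlin => /(congr1 snd) /=; rewrite scale1r !scaleNr.
rewrite -/r; set a := (r (x1, 0)).2; set b := (r (0, C1 h)).2.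
set c := (r (x2, 0)).2; set d := (r (0, C2 h)).2 => <-.
by apply/eqP; rewrite eq_sym subr_eq addrCA addNKr addrA (addrC _ c).
Qed.

End Correspondence.

(** * From solutions to extensions *)

Section SolutionExtension.
Variables (R : realType) (X : lmodType R[i]) (L : hilbertType R).
Variables (B1 B2 : {linear X -> X}) (C1 C2 : {linear X -> L}).
Variable K : {bilinear X -> X -> R[i] | *%R & (Num.conj : R[i] -> R[i]) \; *%R}.
Hypothesis K_ge0 : forall h : X, 0 <= K h h.
Hypothesis K_id : forall h g : X, K (B2 h) (B1 g) - K (B1 h) (B2 g)
  = '[< C1 h, C2 g >] - '[< C2 h, C1 g >].
Variables (H : hilbertType R) (hat : {linear X -> H}).
Hypothesis hatK : is_completion K hat.
Variables (phi psi : opfun L).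
Hypothesis nev : normalized_nevanlinna_pair phi psi.
Variables (S : rkhs (nkernel phi psi)) (F : {linear X -> S}).
Hypothesis aip : aip_mapping B1 B2 C1 C2 K F.

Let hL := hdot_hilbert L.
Let hS := hdot_hilbert S.
Let hK := bilinear_semi_inner K_ge0.
Let sp := normalized_symmetric nev.

Local Notation model := (@model _ _ _ _ S).

Lemma graph_in_model h :
  model ((F (B1 h), C1 h), (F (B2 h), C2 h)).
Proof. by apply/(modelP nev) => z z0; exact: (proj1 aip). Qed.

Definition defect (h g : X) : R[i] := K h g - '[< F h, F g >].

Lemma defect_semi : semi_inner defect.
Proof.
split=> [x y z|a x z|x y|x]; rewrite /defect.
- by rewrite (siDl hK) linearD (siDl hS) opprD addrACA.
- by rewrite (siZl hK) linearZ (siZl hS) mulrBr.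
- by rewrite (siC hK) (siC hS) -rmorphB.
- by rewrite subr_ge0 -sqr_norm_hdot (proj2 aip).
Qed.

(** The data satisfy the same identity for K and, in the symmetric relation
    [model], for the inner product of S; the terms from L cancel. *)
Lemma defect_symmetric h g : defect (B2 h) (B1 g) = defect (B1 h) (B2 g).
Proof.
have hg := graph_in_model g; rewrite -(model_selfadjoint nev) in hg.
have := hg _ (graph_in_model h); rewrite /sdot /= /defect => e.
have eK : K (B2 h) (B1 g) = K (B1 h) (B2 g) + ('[< C1 h, C2 g >] - '[< C2 h, C1 g >]).
  by rewrite -K_id addrC subrK.
have eF : '[< F (B2 h), F (B1 g) >]
    = '[< F (B1 h), F (B2 g) >] + ('[< C1 h, C2 g >] - '[< C2 h, C1 g >]).
  by rewrite addrA -e addrK.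
by rewrite eK eF; ring.
Qed.

(** The resolvent of the sum maps (0, u) to the kernel function at the conjugate
    point and psi(z) u, because it does so in the model relation; pairing with
    these vectors gives its values on the vectors of H. *)
Theorem solution_gives_extension : exists E : sa_extension_with_exit B1 B2 C1 C2 hat,
  param_formula E phi psi /\ mapping_formula E F.
Proof.
have [H' [q hq]] := completion_exists defect_semi.
have hH' := hdot_hilbert H'.
pose Bq : set (H' * H') := [set p | exists h, p = (q (B1 h), q (B2 h))].
have sBq : Bq `<=` radj hdot Bq.
  by move=> _ [g ->] _ [h ->] /=; rewrite !hq defect_symmetric.
have hHH := pform_hilbert hH' hH'; have hX := pform_hilbert hS hHH.
pose Ex : hilbertType R := form_space hX.
pose f1 (e : Ex) : S := e.1.
pose f2 (e : Ex) : H' * H' := e.2.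
have dotE (e e' : Ex) : '[< e, e' >] = '[< f1 e, f1 e' >] + pform hdot hdot (f2 e) (f2 e').
  by [].
pose mk (s : S) (x : H' * H') : Ex := (s, x).
have mkD s s' x x' : mk s x + mk s' x' = mk (s + s') (x + x') by [].
have mkZ a s x : a *: mk s x = mk (a *: s) (a *: x) by [].
pose T0 h : Ex := mk (F h) (q h, 0).
have T0lin : linear T0.
  move=> a h g; rewrite /T0 mkZ mkD !linearP; congr mk.
  by congr pair => /=; rewrite scaler0 addr0.
have [T hT] := linear_bundle T0lin.
have [incl [inclT incl_iso]] : exists T' : {linear H -> Ex},
    (forall h, T' (hat h) = T h) /\ forall x y, '[< T' x, T' y >] = '[< x, y >].
  apply: isometry_extension; first exact: (proj2 hatK).
  move=> h g; rewrite (proj1 hatK) !hT dotE /pform /= hq /defect (si0l hH') addr0.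
  by rewrite addrC subrK.
(* The exit space is S + (H' + H'): the dilation takes place in H' + H' and the
   model relation in S + L. *)
pose J (x : Ex * L) : (S * L) * (H' * H') := ((f1 x.1, x.2), f2 x.1).
pose rel : set ((Ex * L) * (Ex * L)) :=
  [set p | dsum_rel model (dilation hdot Bq) (J p.1, J p.2)].
have rel_sa : selfadjoint_relation rel.
  rewrite /selfadjoint_relation.
  have := @radj_pullback R (Ex * L)%type ((S * L) * (H' * H'))%type (@sdot R Ex L)
    (pform (@sdot R S L) (pform hdot hdot)) J
    (dsum_rel model (dilation hdot Bq)).
  move=> h; symmetry; apply: h.
  - by move=> [[s u] x]; exists (mk s x, u).
  - by move=> x y; rewrite /pform /sdot /= dotE addrAC.
  - apply: (radj_dsum (sdot_hilbert S L) hHH); first exact: (model_selfadjoint nev).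
    exact: (radj_dilation hH').
have rel_ext x u y v : Ahat B1 B2 C1 C2 hat ((x, u), (y, v)) ->
    rel ((incl x, u), (incl y, v)).
  move=> [h _ [<- <- <- <-]]; rewrite !inclT !hT; split=> /=.
    exact: graph_in_model.
  by apply: (dilation_extends hH') => //; exists h.
pose E : sa_extension_with_exit B1 B2 C1 C2 hat := SaExtension incl_iso rel_sa rel_ext.
have hEL := sdot_hilbert Ex L.
have rA := selfadjoint_radj rel_sa.
have reskey z u : nonreal z -> exists2 k : S, is_kernel (S := S) z^* u k &
    res rel z (0, u) = (mk k 0, psi z u).
  move=> z0; have zJ := nonrealJ z0; have [k hk] := ev_kernel S u zJ.
  exists k => //; apply: (res_unique hEL rA); first exact/nonrealP.
  split=> /=.
    apply: (kernel_graph_model nev); exists z^*, u, k; rewrite conjCK; split=> //.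
    by congr pair; congr pair; rewrite ?add0r // (sp_phi sp) // addrC.
  have [D0 _ _] := radj_subspace (pform_semi hH' hH') (dilation hdot Bq).
  rewrite (radj_dilation hH') in D0; move: D0; congr (dilation _ _ _).
  by congr pair; rewrite /f2 /mk /= scaler0 addr0.
exists E; split.
  apply/param_formulaE => z z0; split=> u; last exact: (sp_phi sp).
  by have [k _] := reskey z u z0 => /= ->.
move=> h z z0 v.
have -> : ev S z (F h) = (res rel z (incl (hat h), 0)).2.
  apply: (hf_inj hL) => u.
  have [k hk rk] := reskey z^* u (nonrealJ z0).
  have := res_adjoint hEL rA (incl (hat h), 0) (0, u) (proj1 (nonrealP _) z0).
  rewrite rk inclT hT /sdot /= (si0l hL) (si0r (hdot_hilbert Ex)) add0r addr0 => ->.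
  rewrite dotE /pform /= !(si0r hH') !addr0.
  by move: (proj2 hk); rewrite conjCK => ->.
split=> [<-|/(compressed_resolventE rel_sa _ _ z0) -> //].
exact/(compressed_resolventE rel_sa _ _ z0).
Qed.

End SolutionExtension.

(** * Existence of extensions and the main theorem *)

Section ExtensionExists.
Variables (R : realType) (X : lmodType R[i]) (L : hilbertType R).
Variables (B1 B2 : {linear X -> X}) (C1 C2 : {linear X -> L}).
Variable K : {bilinear X -> X -> R[i] | *%R & (Num.conj : R[i] -> R[i]) \; *%R}.
Hypothesis K_id : forall h g : X, K (B2 h) (B1 g) - K (B1 h) (B2 g)
  = '[< C1 h, C2 g >] - '[< C2 h, C1 g >].
Variables (H : hilbertType R) (hat : {linear X -> H}).
Hypothesis hatK : forall h g, '[< hat h, hat g >] = K h g.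

Lemma Ahat_symmetric : Ahat B1 B2 C1 C2 hat `<=`
  radj (@sdot R H L) (Ahat B1 B2 C1 C2 hat).
Proof.
move=> _ [g _ <-] _ [h _ <-]; rewrite /sdot /= !hatK.
have -> : K (B2 h) (B1 g) = K (B1 h) (B2 g) + ('[< C1 h, C2 g >] - '[< C2 h, C1 g >]).
  by rewrite -K_id addrC subrK.
by rewrite addrA subrK.
Qed.

(** The dilation of the data relation, in (H + L) + (H + L), is regarded as a
    relation in (H + (H + L)) + L: the first copy of L is kept as the
    distinguished summand. *)
Theorem extension_exists : exists _ : sa_extension_with_exit B1 B2 C1 C2 hat, True.
Proof.
have hH := hdot_hilbert H; have hHL := sdot_hilbert H L.
pose Ex : hilbertType R := form_space (pform_hilbert hH hHL).
have dotE (e e' : Ex) : '[< e, e' >] = '[< e.1, e'.1 >] + sdot e.2 e'.2 by [].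
pose J (x : Ex * L) : (H * L) * (H * L) := ((x.1.1, x.2), x.1.2).
pose rel : set ((Ex * L) * (Ex * L)) :=
  [set p | dilation (@sdot R H L) (Ahat B1 B2 C1 C2 hat) (J p.1, J p.2)].
pose incl0 x : Ex := (x, 0).
have incl0_lin : linear incl0.
  by move=> a x y; congr pair => /=; rewrite scaler0 addr0.
have [incl inclE] := linear_bundle incl0_lin.
have incl_iso x y : '[< incl x, incl y >] = '[< x, y >].
  by rewrite !inclE dotE /= (si0l hHL) addr0.
have rel_sa : selfadjoint_relation rel.
  have h := @radj_pullback R (Ex * L)%type ((H * L) * (H * L))%type (@sdot R Ex L)
    (pform (@sdot R H L) (@sdot R H L)) J
    (dilation (@sdot R H L) (Ahat B1 B2 C1 C2 hat)).
  symmetry; apply: h.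
  - by move=> [[s u] x]; exists ((s, x) : Ex, u).
  - by move=> x y; rewrite /pform {1 3}/sdot /= dotE addrAC.
  - exact: (radj_dilation hHL).
have rel_ext x u y v : Ahat B1 B2 C1 C2 hat ((x, u), (y, v)) ->
    rel ((incl x, u), (incl y, v)).
  move=> Axy; rewrite /rel /= /J !inclE /=.
  exact: (dilation_extends hHL Ahat_symmetric).
by exists (SaExtension incl_iso rel_sa rel_ext).
Qed.

End ExtensionExists.

Theorem theorem3p3 (R : realType) (X : lmodType R[i]) (L : hilbertType R)
    (B1 B2 : {linear X -> X}) (C1 C2 : {linear X -> L})
    (K : {bilinear X -> X -> R[i] | *%R & (Num.conj : R[i] -> R[i]) \; *%R})
    (K_ge0 : forall h : X, 0 <= K h h)
    (K_id : forall h g : X,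
      K (B2 h) (B1 g) - K (B1 h) (B2 g)
      = '[< C1 h, C2 g >] - '[< C2 h, C1 g >]) :
  (exists phi psi : opfun L, aip_solution B1 B2 C1 C2 K phi psi) /\
  (forall (H : hilbertType R) (hat : {linear X -> H}), is_completion K hat ->
    [/\ (* the formula associates a pair with every extension *)
        forall E : sa_extension_with_exit B1 B2 C1 C2 hat,
          exists phi psi : opfun L, param_formula E phi psi,
        (* the normalized solutions are exactly the pairs so obtained *)
        forall phi psi : opfun L,
          aip_solution B1 B2 C1 C2 K phi psi <->
          exists E : sa_extension_with_exit B1 B2 C1 C2 hat,
            param_formula E phi psi,
        (* the formula for F gives a mapping solving the problem *)
        forall (E : sa_extension_with_exit B1 B2 C1 C2 hat)
            (phi psi : opfun L), param_formula E phi psi ->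
          exists (S : rkhs (nkernel phi psi)) (F : {linear X -> S}),
            aip_mapping B1 B2 C1 C2 K F /\ mapping_formula E F
      & (* every mapping solving the problem is given by the formula *)
        forall (phi psi : opfun L) (S : rkhs (nkernel phi psi))
            (F : {linear X -> S}),
          normalized_nevanlinna_pair phi psi ->
          aip_mapping B1 B2 C1 C2 K F ->
          exists E : sa_extension_with_exit B1 B2 C1 C2 hat,
            param_formula E phi psi /\ mapping_formula E F]).
Proof.
split; last first.
  move=> H hat hHat; have [hatK _] := hHat; split.
  - move=> E; have sA := exit_rel_selfadjoint E.
    have [phi [psi hp]] := resolvent_pair_ex sA; exists phi, psi.
    exact/param_formulaE.
  - move=> phi psi; split=> [[nev [S [F aip]]]|[E /(extension_gives_solution hatK)]].
      have [E [hE _]] := solution_gives_extension K_ge0 K_id hHat nev aip.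
      by exists E.
    by move=> [nev [S [F [aip _]]]]; split=> //; exists S, F.
  - by move=> E phi psi /(extension_gives_solution hatK)[].
  - by move=> phi psi S F nev aip; exact: (solution_gives_extension K_ge0 K_id hHat nev).
have [H [hat hatK]] := completion_exists (bilinear_semi_inner K_ge0).
have [E _] := extension_exists K_id hatK.
have [phi [psi hp]] := resolvent_pair_ex (exit_rel_selfadjoint E).
exists phi, psi.
have /(extension_gives_solution hatK)[nev [S [F [aip _]]]] : param_formula E phi psi.
  exact/param_formulaE.
by split=> //; exists S, F.
Qed.
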